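(* Consider the directed preferential attachment model with parameters $\alpha,\beta,\gamma,\lambda,\mu$, let $p(i,j)$ be its asymptotic joint mass function of in- and out-degrees, and let $$c_1=\frac{\alpha+\beta}{1+\lambda(\alpha+\gamma)},\qquad c_2=\frac{\beta+\gamma}{1+\mu(\alpha+\gamma)} .$$ Suppose $c_1=c_2$. Then $p(i,j)$ is eventually monotone (eventually decreasing in both arguments), embeddable and standard regularly varying, and for all $x,y>0$ it satisfies $$\lim_{n\to\infty}\frac{p([nx],[ny])}{n^{-(2+1/c_1)}}=\frac{\gamma}{\alpha+\gamma}\,\frac{\Gamma(1+1/c_1+\lambda+\mu)}{c_1\Gamma(\lambda+1)\Gamma(\mu)}\,\frac{x^{\lambda}y^{\mu-1}}{(x+y)^{1+\lambda+\mu+1/c_1}}+\frac{\alpha}{\alpha+\gamma}\,\frac{\Gamma(1+1/c_1+\lambda+\mu)}{c_1\Gamma(\lambda)\Gamma(\mu+1)}\,\frac{x^{\lambda-1}y^{\mu}}{(x+y)^{1+\lambda+\mu+1/c_1}} .$$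
   Context: Model. The parameters $\alpha,\beta,\gamma,\lambda,\mu$ are strictly positive with $\alpha+\beta+\gamma=1$ and $\alpha,\beta,\gamma<1$. Start from a finite directed graph $G(n_0)$ with at least one node and $n_0$ edges. For $n\ge n_0$, $G(n)$ has $n$ edges and a random number $N(n)$ of nodes; $D_{in}(v),D_{out}(v)$ denote the in- and out-degree of $v$ in $G(n)$. $G(n+1)$ is obtained from $G(n)$ as follows. (i) With probability $\alpha$, a new node $w$ is born with an edge from $w$ to an existing node $v$, chosen with probability $(D_{in}(v)+\lambda)/(n+\lambda N(n))$. (ii) With probability $\beta$, an edge from $v$ to $w$ is added between existing nodes, where $v$ and $w$ are chosen independently, $v$ with probability $(D_{out}(v)+\mu)/(n+\mu N(n))$ and $w$ with probability $(D_{in}(w)+\lambda)/(n+\lambda N(n))$. (iii) With probability $\gamma$, a new node $w$ is born with an edge from an existing node $v$ to $w$, where $v$ is chosen with probability $(D_{out}(v)+\mu)/(n+\mu N(n))$. Let $N_{ij}(n)$ be the number of nodes of $G(n)$ with in-degree $i$ and out-degree $j$. It is known that there are non-random constants $p(i,j)$ with $N_{ij}(n)/N(n)\to p(i,j)$ almost surely, $i,j=0,1,2,\dots$. It is also known that $p(i,j)=\mathbf{P}[I=i,O=j]$, where $$(I,O)\stackrel{d}{=}B(1+X_1,Y_1)+(1-B)(X_2,1+Y_2),$$ $B$ is Bernoulli, independent of $(X_j,Y_j)$, $j=1,2$, with $\mathbf{P}(B=1)=\gamma/(\alpha+\gamma)$, and, with $a=c_2/c_1$, $$(X_1,Y_1)=(T_{\lambda+1}(Z^{-1}),\tilde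 T_{\mu}(Z^{-a})),\qquad (X_2,Y_2)=(T_{\lambda}(Z^{-1}),\tilde T_{\mu+1}(Z^{-a})).$$ Here $Z$ is Pareto on $[1,\infty)$ with $\mathbf{P}(Z>z)=z^{-1/c_1}$, $z\ge1$; $\{T_\delta(q)\}$ and $\{\tilde T_\delta(q)\}$, $q\in(0,1)$, are independent families of negative binomial variables, independent of $Z$, with $\mathbf{P}(T_\delta(q)=i)=\frac{\Gamma(i+\delta)}{\Gamma(\delta)\Gamma(i+1)}q^\delta(1-q)^i$, $i=0,1,2,\dots$. Terminology. $[x]$ is the largest integer $\le x$. For $\rho\in\mathbb{R}$, $h\in RV_\rho$ means that $h:(0,\infty)\to(0,\infty)$ is measurable and $\lim_{t\to\infty}h(tx)/h(t)=x^\rho$ for all $x>0$. $p$ is standard regularly varying if for some $\rho\in\mathbb{R}$ and $h\in RV_\rho$ the limit $\lim_{n\to\infty}p([nx],[ny])/h(n)$ exists and is positive for all $x,y>0$. $p$ is embeddable if $g(x,y):=p([x],[y])$ is regularly varying as a function of continuous variables, i.e. $\lim_{t\to\infty}g(tx,ty)/h(t)$ ($t$ real) exists and is positive for all $x,y>0$, for some such $h$. ''Eventually decreasing in both arguments'' means: there is $M$ such that for $i,j\ge M$, $p(i,j)$ is non-increasing in $i$ and in $j$.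
   Formalization: ''Eventually decreasing in both arguments'' with one common M is false if λ>1 or μ>1 (e.g. α=γ=0.3, β=0.4, λ=μ=2); it is proved for λ,μ≤1, and for all parameters with a threshold for each argument that may depend on the other argument. *)

(* Defs.v *)
From HB Require Import structures.
From mathcomp Require Import all_boot all_order all_algebra.
From mathcomp Require Import all_classical all_reals all_analysis.

Set Implicit Arguments.
Unset Strict Implicit.
Unset Printing Implicit Defensive.

Import Order.TTheory GRing.Theory Num.Theory numFieldNormedType.Exports.

Local Open Scope classical_set_scope.
Local Open Scope ring_scope.

(* Finite directed multigraphs, loops allowed. [(N, s)] has the nodes
   0, ..., N - 1, and [s] lists its edges (source, target) in order of
   creation; a newborn node receives the label N. *)
Definition digraph := (nat * seq (nat * nat))%type.

Definition num_nodes (g : digraph) : nat := g.1.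
Definition num_edges (g : digraph) : nat := size g.2.

Definition wf_digraph (g : digraph) : bool :=
  all (fun e => (e.1 < num_nodes g)%N && (e.2 < num_nodes g)%N) g.2.

Definition in_degree (g : digraph) (v : nat) : nat :=
  count (fun e : nat * nat => e.2 == v) g.2.
Definition out_degree (g : digraph) (v : nat) : nat :=
  count (fun e : nat * nat => e.1 == v) g.2.

Definition num_nodes_deg (g : digraph) (i j : nat) : nat :=
  #|[pred v : 'I_(num_nodes g) | (in_degree g v == i) && (out_degree g v == j)]|.

Definition add_edge (g : digraph) (v w : nat) : digraph :=
  (num_nodes g, rcons g.2 (v, w)).
Definition add_source (g : digraph) (v : nat) : digraph :=
  ((num_nodes g).+1, rcons g.2 (num_nodes g, v)).
Definition add_target (g : digraph) (v : nat) : digraph :=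
  ((num_nodes g).+1, rcons g.2 (v, num_nodes g)).

Section model.
Variable R : realType.
Implicit Types alpha beta gamma lambda mu : R.

Definition pa_params alpha beta gamma lambda mu : Prop :=
  [/\ 0 < alpha < 1, 0 < beta < 1, 0 < gamma < 1,
      alpha + beta + gamma = 1 & 0 < lambda /\ 0 < mu].

Definition pick_in lambda (g : digraph) (v : nat) : R :=
  ((in_degree g v)%:R + lambda)
  / ((num_edges g)%:R + lambda * (num_nodes g)%:R).
Definition pick_out mu (g : digraph) (v : nat) : R :=
  ((out_degree g v)%:R + mu)
  / ((num_edges g)%:R + mu * (num_nodes g)%:R).

Definition pa_kernel alpha beta gamma lambda mu (g g' : digraph) : R :=
  alpha * (\sum_(v < num_nodes g)
             pick_in lambda g v * (g' == add_source g v)%:R)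
  + beta * (\sum_(v < num_nodes g) \sum_(w < num_nodes g)
             pick_out mu g v * pick_in lambda g w * (g' == add_edge g v w)%:R)
  + gamma * (\sum_(v < num_nodes g)
             pick_out mu g v * (g' == add_target g v)%:R).

(* [G n] is the graph G(n) for n >= n0; the values [G n] with n < n0 are
   irrelevant. The field [pa_step] says that, given G(n0), ..., G(n), the
   conditional law of G(n + 1) is [pa_kernel _ _ _ _ _ (G n)]. *)
Record pa_process alpha beta gamma lambda mu (n0 : nat) (g0 : digraph)
    (d : measure_display) (Omega : measurableType d) (P : probability Omega R)
    (G : nat -> Omega -> digraph) : Prop := {
  pa_wf : wf_digraph g0;
  pa_nodes : (0 < num_nodes g0)%N;
  pa_edges : num_edges g0 = n0;
  pa_meas : forall n g, (n0 <= n)%N -> measurable [set w | G n w = g];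
  pa_init : P [set w | G n0 w = g0] = 1%E;
  pa_step : forall n (h : nat -> digraph) (g : digraph), (n0 <= n)%N ->
    P [set w | (forall k, (n0 <= k <= n)%N -> G k w = h k) /\ G n.+1 w = g]
    = (P [set w | forall k, (n0 <= k <= n)%N -> G k w = h k]
       * (pa_kernel alpha beta gamma lambda mu (h n) g)%:E)%E }.

Definition asymptotic_joint_pmf (d : measure_display) (Omega : measurableType d)
    (P : probability Omega R) (G : nat -> Omega -> digraph)
    (p : nat -> nat -> R) : Prop :=
  forall i j, {ae P, forall w,
    (num_nodes_deg (G n w) i j)%:R / (num_nodes (G n w))%:R
      @[n --> \oo] --> p i j}.

Definition c1 alpha beta gamma lambda : R :=
  (alpha + beta) / (1 + lambda * (alpha + gamma)).
Definition c2 alpha beta gamma mu : R :=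
  (beta + gamma) / (1 + mu * (alpha + gamma)).

Definition Gamma (z : R) : R :=
  \int[lebesgue_measure]_(x in `]0, +oo[) (x `^ (z - 1) * expR (- x)).

Definition negbin_pmf (delta q : R) (i : nat) : R :=
  Gamma (i%:R + delta) / (Gamma delta * Gamma (i%:R + 1))
  * q `^ delta * (1 - q) ^+ i.

(* A family T_delta(q), on a probability space (E, Q). The value at a random q
   is a random variable only if T_delta is jointly measurable; the values for
   q outside ]0, 1[ are immaterial. *)
Definition negbin_family (d : measure_display) (E : measurableType d)
    (Q : probability E R) (T : R -> R -> E -> nat) : Prop :=
  forall delta, 0 < delta ->
    measurable_fun [set: measurableTypeR R * E] (fun x => T delta x.1 x.2) /\
    (forall q i, 0 < q < 1 ->
       Q [set e | T delta q e = i] = (negbin_pmf delta q i)%:E).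

(* p(i,j) = P[I = i, O = j]. As only the law of (I, O) matters, B, Z, (T_delta)
   and (T'_delta) live on the four factors of a product space, which is
   what makes them independent. *)
Definition mixture_representation alpha beta gamma lambda mu
    (p : nat -> nat -> R) : Prop :=
  let c1 := c1 alpha beta gamma lambda in
  let a := c2 alpha beta gamma mu / c1 in
  exists (dB dZ dT dT' : measure_display)
    (EB : measurableType dB) (EZ : measurableType dZ)
    (ET : measurableType dT) (ET' : measurableType dT')
    (PB : probability EB R) (PZ : probability EZ R)
    (PT : probability ET R) (PT' : probability ET' R)
    (B : EB -> bool) (Z : EZ -> R)
    (T : R -> R -> ET -> nat) (T' : R -> R -> ET' -> nat),
  [/\ measurable_fun setT B /\
      PB [set e | B e] = (gamma / (alpha + gamma))%:E,
      measurable_fun setT (Z : EZ -> measurableTypeR R) /\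
      (forall z, 1 <= z -> PZ [set e | z < Z e] = (z `^ (- (1 / c1)))%:E),
      negbin_family PT T,
      negbin_family PT' T' &
      forall i j,
      let X1 e := T (lambda + 1) (Z e.2.1)^-1 e.2.2.1 in
      let Y1 e := T' mu (Z e.2.1 `^ (- a)) e.2.2.2 in
      let X2 e := T lambda (Z e.2.1)^-1 e.2.2.1 in
      let Y2 e := T' (mu + 1) (Z e.2.1 `^ (- a)) e.2.2.2 in
      let I e := if B e.1 then (1 + X1 e)%N else X2 e in
      let O e := if B e.1 then Y1 e else (1 + Y2 e)%N in
      (PB \x (PZ \x (PT \x PT')))%E
        [set e : EB * (EZ * (ET * ET')) | I e = i /\ O e = j] = (p i j)%:E].

Definition regularly_varying (rho : R) (h : R -> R) : Prop :=
  [/\ forall t, 0 < t -> 0 < h t,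
      measurable_fun (`]0, +oo[ : set (measurableTypeR R)) h &
      forall x, 0 < x -> h (t * x) / h t @[t --> +oo] --> x `^ rho].

Definition standard_regularly_varying (p : nat -> nat -> R) : Prop :=
  exists rho h, regularly_varying rho h /\
    forall x y : R, 0 < x -> 0 < y -> exists2 l : R, 0 < l &
      p (Num.truncn (n%:R * x)) (Num.truncn (n%:R * y)) / h n%:R
        @[n --> \oo] --> l.

Definition embeddable (p : nat -> nat -> R) : Prop :=
  let g (x y : R) := p (Num.truncn x) (Num.truncn y) in
  exists rho h, regularly_varying rho h /\
    forall x y : R, 0 < x -> 0 < y -> exists2 l : R, 0 < l &
      g (t * x) (t * y) / h t @[t --> +oo] --> l.

Definition eventually_decreasing (p : nat -> nat -> R) : Prop :=
  exists M : nat,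
    (forall i i' j, (M <= i <= i')%N -> (M <= j)%N -> p i' j <= p i j) /\
    (forall i j j', (M <= i)%N -> (M <= j <= j')%N -> p i j' <= p i j).

(* Unlike in [eventually_decreasing], the threshold for one argument may depend
   on the other argument. For the model with c1 = c2,
   p(i + 1, j) / p(i, j) -> (i + lambda) / (i + 1) as j -> +oo with i >= 1
   fixed, so no common threshold exists when lambda > 1; symmetrically when
   mu > 1. *)
Definition eventually_decreasing_coordinatewise (p : nat -> nat -> R) : Prop :=
  (forall j, exists M : nat, forall i i', (M <= i <= i')%N -> p i' j <= p i j) /\
  (forall i, exists M : nat, forall j j', (M <= j <= j')%N -> p i j' <= p i j).

End model.

(* Main.v *)
Require Import Defs.
From HB Require Import structures.
From mathcomp Require Import all_boot all_order all_algebra.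
From mathcomp Require Import all_classical all_reals all_analysis.
From mathcomp Require Import measurable_realfun ring lra.

(* Write q = 1/Z and k = 1/c_1, so P(q < u) = u^k on ]0, 1[. As c_1 = c_2, both
   negative binomial factors have the same success probability q, and
   E[q^b (1 - q)^m] = k B(k + b, m + 1), by induction on m from
   E[q^b] = k/(k + b). With s = 1 + k + lambda + mu this gives, for
   (i, j) <> (0, 0),
     p(i, j) = Gamma(i + lambda)/Gamma(i + 1) * Gamma(j + mu)/Gamma(j + 1)
               * Gamma(i + j)/Gamma(i + j + s) * (a i + b j),
   where a and b are the constants of the two terms of the limit. Wendel's
   inequality Gamma(x + c) <= x^c Gamma(x), 0 <= c <= 1, yields
   Gamma(x + c) ~ x^c Gamma(x), hence the limit along real t, which contains
   both forms of regular variation. Monotonicity reads off from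
   p(i + 1, j)/p(i, j), a rational function of i and j. When lambda, mu <= 1 the
   leading part of the numerator of 1 - p(i + 1, j)/p(i, j) is a quadratic form,
   nonnegative for i, j >= 0 thanks to the relation between the parameters that
   c_1 = c_2 expresses. *)

Set Implicit Arguments.
Unset Strict Implicit.
Unset Printing Implicit Defensive.

Import Order.TTheory GRing.Theory Num.Theory numFieldNormedType.Exports.

Local Open Scope classical_set_scope.
Local Open Scope ring_scope.

(** * Real powers and exponential bounds *)

Section powR_facts.
Variable R : realType.
Implicit Types a c x y : R.

Lemma continuous_powR_gt0 c x : 0 < x -> {for x, continuous (fun y => y `^ c)}.
Proof.
move=> x0; apply: differentiable_continuous; apply/derivable1_diffP.
by apply: derivable_powR; rewrite in_itv/= x0.
Qed.

(** The absolute value secures two-sided continuity at 0, which matters when 0 is the limit point or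
    corresponds to an endpoint of integration. *)
Lemma continuous_norm_powR c : 0 < c -> continuous (fun x => `|x| `^ c).
Proof.
move=> c0 x; have [->|x0] := eqVneq x 0.
  apply/cvgrPdist_lt => /= e e0; rewrite normr0 powR0 ?gt_eqF//.
  apply/nbhs_ballP; exists (e `^ c^-1) => /=; first exact: powR_gt0.
  move=> y; rewrite /ball/= !sub0r !normrN => ye.
  rewrite ger0_norm ?powR_ge0//.
  have -> : e = (e `^ c^-1) `^ c.
    by rewrite -powRrM mulVf ?gt_eqF// powRr1// ltW.
  by rewrite gt0_ltr_powR// nnegrE ?powR_ge0.
apply: (@continuous_comp _ _ _ (fun y : R => `|y|) (fun y => y `^ c)).
  exact: norm_continuous.
by apply: continuous_powR_gt0; rewrite normr_gt0.
Qed.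

(** Weighted AM-GM, as Young's inequality for the product of 1 and x^a with exponents 1/(1 - a) and
    1/a; these do not exist for a = 0 or 1, treated apart. *)
Lemma powR_le_affine a x : 0 <= a <= 1 -> 0 < x -> x `^ a <= 1 - a + a * x.
Proof.
move=> /andP[a0 a1] x0; have [->|an0] := eqVneq a 0.
  by rewrite powRr0 subr0 mul0r addr0.
have [->|an1] := eqVneq a 1; first by rewrite powRr1 ?subrr ?add0r ?mul1r// ltW.
have a_gt0 : 0 < a by rewrite lt_def an0.
have b_gt0 : 0 < 1 - a by rewrite subr_gt0 lt_def eq_sym an1.
have := @conjugate_powR R 1 (x `^ a) (1 - a)^-1 a^-1 ler01 (powR_ge0 _ _).
rewrite !invr_gt0 !invrK => /(_ b_gt0 a_gt0); rewrite subrK => /(_ erefl).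
have -> : (x `^ a) `^ a^-1 = x by rewrite -powRrM mulfV// powRr1// ltW.
by rewrite powR1 !mul1r (mulrC x).
Qed.

(** A Taylor term of e^(x/2) dominates the power, so half of the exponential survives. It gives
    integrability at infinity and kills boundary terms. *)
Lemma powR_expR_bound a : 0 <= a ->
  exists2 C, 0 < C & forall x, 0 < x -> x `^ a * expR (- x) <= C * expR (- (x / 2)).
Proof.
move=> a0; pose n := Num.truncn a.
have an : a <= n.+1%:R by rewrite ltW// truncnS_gt.
(* This constant turns the Taylor term (x/2)^(n+1)/(n+1)! into x^(n+1), with n + 1 above the
   exponent a. *)
pose C : R := 2 ^+ n.+1 * (n.+1)`!%:R.
have C0 : 0 < C by rewrite mulr_gt0// ?exprn_gt0// ltr0n fact_gt0.
have C1 : 1 <= C.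
  by rewrite mulr_ege1// ?exprn_ege1// ?ler1n ?fact_gt0//.
exists C => // x x0.
have -> : expR (- x) = expR (- (x / 2)) * expR (- (x / 2)).
  by rewrite -expRD; congr expR; lra.
rewrite mulrA ler_pM2r ?expR_gt0// expRN ler_pdivrMr ?expR_gt0//.
apply: (@le_trans _ _ (1 + x ^+ n.+1)).
  have [x1|x1] := leP x 1.
    apply: (@le_trans _ _ 1); last by rewrite lerDl exprn_ge0// ltW.
    by rewrite -(powRr0 x) ger_powR// x0.
  rewrite (le_trans (ler_powR (ltW x1) an))// powR_mulrn ?ltW//.
  by rewrite ltrDr.
apply: (@le_trans _ _ (C * (1 + (x / 2) ^+ n.+1 / n.+1`!%:R))); last first.
  by rewrite ler_pM2l// expR_ge1Dxn// divr_ge0// ltW.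
rewrite mulrDr mulr1 lerD// /C expr_div_n.
have f0 : n.+1`!%:R != 0 :> R by rewrite pnatr_eq0 -lt0n fact_gt0.
by rewrite mulrACA mulrA -mulrA divff// mulr1 mulrCA divff ?mulr1// expf_neq0.
Qed.

Lemma cvg_1D_divr a : (1 + a / x) @[x --> +oo] --> (1 : R).
Proof.
have inv0 : x^-1 @[x --> +oo] --> (0 : R).
  apply/cvgrPdist_lt => e e0; near=> x.
  have ex : e^-1 < x by near: x; apply: nbhs_pinfty_gt; rewrite num_real.
  have x0 : 0 < x by rewrite (lt_trans _ ex)// invr_gt0.
  by rewrite sub0r normrN gtr0_norm ?invr_gt0// invf_plt ?posrE.
suff : (1 + a / x) @[x --> +oo] --> 1 + a * 0 by rewrite mulr0 addr0.
by apply: cvgD; [exact: cvg_cst|apply: cvgM => //; exact: cvg_cst].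
Unshelve. all: by end_near. Qed.

End powR_facts.

(** * The Gamma function: recursion, finiteness, positivity and asymptotics *)

Section gamma_function.
Variable R : realType.
Implicit Types a x z : R.
Notation mu := (@lebesgue_measure R).
Local Notation Gamma := (@Gamma R).

(** Euler's integral with values in the extended reals: nonnegative integrands can be handled before
    finiteness is known. *)
Let eGamma z :=
  (\int[mu]_(x in `]0%R, +oo[) (x `^ (z - 1) * expR (- x))%:E)%E.

Let integrand_ge0 z x : (0 <= (x `^ (z - 1) * expR (- x))%:E)%E.
Proof. by rewrite lee_fin mulr_ge0 ?powR_ge0 ?expR_ge0. Qed.

Let measurable_integrand z (D : set R) :
  measurable_fun D (fun x => x `^ (z - 1) * expR (- x)).
Proof.
apply: measurable_funTS; apply: measurable_funM; first exact: measurable_powR.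
apply: measurableT_comp; first exact: measurable_expR.
exact: measurable_funN.
Qed.

(** Compact intervals exhausting the half-line away from the possible singularity at 0. With [n.+2]
    the endpoints are distinct already for n = 0. *)
Let box (n : nat) : set R := `[n.+2%:R^-1, n.+2%:R].

Let bigcup_box : \bigcup_n box n = `]0, +oo[%classic.
Proof.
apply/seteqP; split => x /=.
  by move=> [n _]; rewrite /box/= !in_itv/= andbT => /andP[+ _]; apply: lt_le_trans;
     rewrite invr_gt0.
rewrite in_itv/= andbT => x0.
exists (Num.truncn (x + x^-1)) => //; rewrite /box/= in_itv/=.
have : x + x^-1 < (Num.truncn (x + x^-1)).+2%:R.
  by rewrite (lt_trans (truncnS_gt _))// ltr_nat.
have y0 : 0 < x^-1 by rewrite invr_gt0.
move=> h; apply/andP; split; last first.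
  by rewrite ltW// (le_lt_trans _ h)// lerDl ltW.
by rewrite invf_ple ?posrE ?ltr0Sn// ltW// (le_lt_trans _ h)// lerDr ltW.
Qed.

Let eGamma_cvg z :
  (\int[mu]_(x in box n) (x `^ (z - 1) * expR (- x))%:E)%E @[n --> \oo]
  --> eGamma z.
Proof.
rewrite /eGamma -bigcup_box; apply: ge0_nondecreasing_set_cvg_integral => //.
- move=> m n mn; apply/subsetPset => x; rewrite /box/= !in_itv/= => /andP[h1 h2].
  rewrite (le_trans _ h1) ?(le_trans h2) ?ler_nat//.
  by rewrite lef_pV2 ?posrE ?ltr0Sn// ler_nat.
- by move=> n; exact: measurable_itv.
- by move=> n; apply/measurable_EFinP; exact: measurable_integrand.
Qed.

Let box_by_parts z n : 0 < z ->
  (\int[mu]_(x in box n) (x `^ (z + 1 - 1) * expR (- x))%:E)%E =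
  ((n.+2%:R^-1 `^ z * expR (- n.+2%:R^-1) - n.+2%:R `^ z * expR (- n.+2%:R))%:E
   + z%:E * \int[mu]_(x in box n) (x `^ (z - 1) * expR (- x))%:E)%E.
Proof.
move=> z0.
have n0 : 0 < n.+2%:R^-1 :> R by rewrite invr_gt0.
have nn : n.+2%:R^-1 < n.+2%:R :> R.
  by rewrite (@lt_trans _ _ 1)// ?invf_lt1 ?ltr1n.
have cE : continuous (fun x : R => expR (- x)).
  by move=> x; apply: continuous_comp;
     [exact: opp_continuous|exact: continuous_expR].
have pos x : x \in box n -> 0 < x.
  by rewrite inE /box/= in_itv/= => /andP[h _]; exact: lt_le_trans h.
have gt0 x : x \in `]n.+2%:R^-1, n.+2%:R[ -> 0 < x.
  by rewrite in_itv/= => /andP[h _]; exact: lt_trans h.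
rewrite addrK (@integration_by_parts _ (fun x => x `^ z)
  (fun x => - expR (- x)) (fun x => z * x `^ (z - 1)) (fun x => expR (- x)))//.
- rewrite !mulrN opprK [X in X%:E]addrC; congr (_ + _)%E.
  rewrite -ge0_integralZl//; last 3 first.
  + exact: measurable_itv.
  + by apply/measurable_EFinP; exact: measurable_integrand.
  + by rewrite lee_fin ltW.
  (* The integrand is nonpositive, so its positive part has integral 0 and the sign may be moved
     inside. *)
  rewrite -integralN /=; last first.
    apply: fin_num_adde_defr; rewrite integral0_eq// => x _.
    rewrite funeposE; apply/max_idPr.
    by rewrite lee_fin mulrN oppr_le0 !mulr_ge0 ?powR_ge0 ?expR_ge0// ltW.
  by apply: eq_integral => x _; rewrite -EFinM; congr EFin; ring.
- apply: continuous_in_subspaceT => x /pos x0.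
  by apply: cvgM; [exact: cvg_cst|exact: continuous_powR_gt0].
- split; first by move=> x /gt0 x0; apply: derivable_powR; rewrite in_itv/= x0.
  + by apply/cvg_at_right_filter; exact: continuous_powR_gt0.
  + by apply/cvg_at_left_filter; apply: continuous_powR_gt0.
- by move=> x /gt0 x0; rewrite powR_derive1// in_itv/= x0.
- exact: continuous_subspaceT.
- split; first by move=> x _; exact: ex_derive.
  + by apply/cvg_at_right_filter; apply: cvgN; exact: cE.
  + by apply/cvg_at_left_filter; apply: cvgN; exact: cE.
- by move=> x _; rewrite derive1E derive_val mulrN1 opprK.
Qed.

(** At the left endpoint x^z tends to 0 because z > 0; at the right endpoint the exponential
    wins. *)
Let cvg_box_boundary z : 0 < z ->
  n.+2%:R^-1 `^ z * expR (- n.+2%:R^-1) - n.+2%:R `^ z * expR (- n.+2%:R)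
    @[n --> \oo] --> (0 : R).
Proof.
move=> z0; rewrite -[X in _ --> X]subr0; apply: cvgB.
  have inv0 : n.+2%:R^-1 @[n --> \oo] --> (0 : R).
    by have := @cvg_harmonic R; rewrite -cvg_shiftS.
  pose f (x : R) := `|x| `^ z * expR (- x).
  have fc : {for 0, continuous f}.
    apply: cvgM; first exact: continuous_norm_powR.
    by apply: continuous_comp; [exact: opp_continuous|exact: continuous_expR].
  have : f n.+2%:R^-1 @[n --> \oo] --> f 0 by apply: continuous_cvg.
  rewrite {2}/f normr0 powR0 ?gt_eqF// mul0r; apply: cvg_trans.
  apply: near_eq_cvg; apply: nearW => n.
  by rewrite /f ger0_norm// invr_ge0.
have [C C0 hC] := powR_expR_bound (ltW z0).
apply: (@squeeze_cvgr _ _ _ _ (fun=> 0) (fun n => C * expR (- (n.+2%:R / 2)))).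
- apply: nearW => n; rewrite mulr_ge0 ?powR_ge0 ?expR_ge0//=.
  by rewrite hC// ltr0Sn.
- exact: cvg_cst.
- rewrite -[X in _ --> X](mulr0 C); apply: cvgM; first exact: cvg_cst.
  apply: (@cvg_comp _ _ _ (fun n => n.+2%:R) (fun x : R => expR (- (x / 2)))
    _ (pinfty_nbhs R)).
    have := @cvgr_idn R; rewrite -(cvg_shiftn 2); apply: cvg_trans.
    by apply: near_eq_cvg; apply: nearW => n /=; rewrite addn2.
  apply: (@cvg_comp _ _ _ (fun x => x / 2) (fun x : R => expR (- x))
    _ (pinfty_nbhs R)); last exact: cvgr_expR.
  apply: gt0_cvgMly; last exact: cvg_id.
  by rewrite invr_gt0.
Qed.

(** The limit of the integrations by parts over the boxes. Being an identity of extended reals, it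
    can itself serve to prove finiteness. *)
Let eGamma_rec z : 0 < z -> eGamma (z + 1) = (z%:E * eGamma z)%E.
Proof.
move=> z0; have h := @eGamma_cvg (z + 1); rewrite -(cvg_lim _ h)//.
apply/cvg_lim => //; rewrite -[X in _ --> X]add0e.
under eq_cvg do rewrite box_by_parts//.
apply: cvgeD; first exact: fin_num_adde_defr.
  by apply: cvg_EFin; [exact: nearW|exact: cvg_box_boundary].
by apply: cvgeZl => //; exact: eGamma_cvg.
Qed.

Let continuous_expR_rate (r : R) : continuous (fun x : R => expR (- (r * x))).
Proof.
move=> x; apply: continuous_comp; last exact: continuous_expR.
by apply: cvgN; apply: cvgM; [exact: cvg_cst|exact: cvg_id].
Qed.

Let measurable_expR_rate (r : R) (D : set R) :
  measurable_fun D (fun x : R => expR (- (r * x))).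
Proof.
apply: measurable_funTS; apply: continuous_measurable_fun.
exact: continuous_expR_rate.
Qed.

Let integral_expR_rate (r : R) : 0 < r ->
  (\int[mu]_(x in `]0%R, +oo[) (expR (- (r * x)))%:E = (r^-1)%:E)%E.
Proof.
move=> r0.
have cE := @continuous_expR_rate r.
have dE (x : R) : is_derive x 1 (fun x : R => - r^-1 * expR (- (r * x)))
    (expR (- (r * x))).
  apply: is_derive_eq.
  by rewrite /GRing.scale/=; field; rewrite gt_eqF.
rewrite integral_itv_obnd_cbnd; last first.
  by apply/measurable_EFinP; exact: measurable_expR_rate.
rewrite (@ge0_continuous_FTC2y _ _ (fun x => - r^-1 * expR (- (r * x))) _ 0)//.
- by rewrite mulr0 oppr0 expR0 mulr1 sub0e EFinN oppeK.
- exact: continuous_subspaceT.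
- rewrite -[X in _ --> X](mulr0 (- r^-1)); apply: cvgM; first exact: cvg_cst.
  apply: (@cvg_comp _ _ _ (fun x => r * x) (fun x : R => expR (- x))
    _ (pinfty_nbhs R)); last exact: cvgr_expR.
  exact: gt0_cvgMry.
- apply/cvg_at_right_filter; apply: cvgM; first exact: cvg_cst.
  exact: cE.
- by move=> x _; rewrite derive1E derive_val.
Qed.

(** For z < 1 the integrand blows up at 0, but at z + 1 it is at most C e^(-x/2); the recursion
    carries finiteness back to z. *)
Let eGamma_fin_num z : 0 < z -> eGamma z \is a fin_num.
Proof.
move=> z0; suff : eGamma (z + 1) \is a fin_num.
  rewrite eGamma_rec// => h.
  have -> : eGamma z = ((z^-1)%:E * (z%:E * eGamma z))%E.
    by rewrite muleA -EFinM mulVf ?gt_eqF// mul1e.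
  exact: fin_numM.
have [C C0 hC] := powR_expR_bound (ltW z0).
rewrite ge0_fin_numE; last exact: integral_ge0.
apply: (@le_lt_trans _ _ (\int[mu]_(x in `]0%R, +oo[)
  (C%:E * (expR (- (2^-1 * x)))%:E))%E).
  apply: ge0_le_integral => //=.
  - apply/measurable_EFinP; exact: measurable_integrand.
  - apply/measurable_EFinP; apply: measurable_funM => //.
    exact: measurable_expR_rate.
  - move=> x; rewrite /= in_itv/= andbT => x0.
    rewrite -EFinM lee_fin addrK mulrC [leRHS]mulrC (mulrC 2^-1) mulrC.
    by rewrite (mulrC _ C) hC.
rewrite ge0_integralZl//.
- by rewrite integral_expR_rate// -EFinM ltry.
- by apply/measurable_EFinP; exact: measurable_expR_rate.
- by rewrite lee_fin ltW.
Qed.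

Let Gamma_EFin z : 0 < z -> (Gamma z)%:E = eGamma z.
Proof. by move=> z0; rewrite /Gamma /Rintegral fineK// eGamma_fin_num. Qed.

Lemma GammaD1 z : 0 < z -> Gamma (z + 1) = z * Gamma z.
Proof.
move=> z0; apply: EFin_inj.
by rewrite EFinM !Gamma_EFin ?eGamma_rec// addr_gt0.
Qed.

Lemma Gamma1 : Gamma 1 = 1.
Proof.
apply: EFin_inj; rewrite Gamma_EFin//; transitivity ((1 : R)^-1%:E)%E.
  rewrite -integral_expR_rate//; apply: eq_integral => x _.
  by rewrite subrr powRr0 !mul1r.
by rewrite invr1.
Qed.

Lemma Gamma_nat n : Gamma n.+1%:R = n`!%:R.
Proof.
elim: n => [|n IH]; first by rewrite Gamma1.
by rewrite -[in LHS]natr1 GammaD1 ?ltr0Sn// IH factS natrM.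
Qed.

(** Integrating a comparison of powers against e^(-x) compares Gamma values; positivity and Wendel's
    inequality are both instances. *)
Let Gamma_le (z u v a b : R) : 0 < z -> 0 < u -> 0 < v -> 0 <= a -> 0 <= b ->
  (forall x, 0 < x -> x `^ (z - 1) <= a * x `^ (u - 1) + b * x `^ (v - 1)) ->
  Gamma z <= a * Gamma u + b * Gamma v.
Proof.
move=> z0 u0 v0 a0 b0 h; have m c w : measurable_fun (`]0, +oo[ : set R)
    (EFin \o (fun x : R => c * (x `^ (w - 1) * expR (- x)))).
  by apply/measurable_EFinP; apply: measurable_funM.
suff : ((Gamma z)%:E <= a%:E * (Gamma u)%:E + b%:E * (Gamma v)%:E)%E.
  by rewrite -!EFinM -EFinD lee_fin.
rewrite (Gamma_EFin z0) (Gamma_EFin u0) (Gamma_EFin v0).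
have E c w : 0 <= c -> (c%:E * eGamma w =
    \int[mu]_(x in `]0%R, +oo[) (c * (x `^ (w - 1) * expR (- x)))%:E)%E.
  move=> c0; rewrite -ge0_integralZl//.
  by apply/measurable_EFinP; exact: measurable_integrand.
have p c w x : 0 <= c -> (0 <= (c * (x `^ (w - 1) * expR (- x)))%:E)%E.
  by move=> c0; rewrite lee_fin !mulr_ge0 ?powR_ge0 ?expR_ge0.
rewrite !E// -ge0_integralD//; [|by move=> x _; exact: p|exact: m
  |by move=> x _; exact: p|exact: m].
apply: ge0_le_integral => //.
- by apply/measurable_EFinP; exact: measurable_integrand.
- by apply: emeasurable_funD; exact: m.
- move=> x; rewrite /= in_itv/= andbT => /h hx.
  by rewrite -EFinD lee_fin !mulrA -mulrDl ler_wpM2r// expR_ge0.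
Qed.

(** With m the integer part of z, x^m <= x^(z-1) for x <= 1 and x^m <= x^z for x > 1, whence m! <=
    Gamma(z) + Gamma(z + 1) = (1 + z) Gamma(z). *)
Lemma Gamma_gt0 z : 0 < z -> 0 < Gamma z.
Proof.
move=> z0; have z1 : 0 < z + 1 by rewrite addr_gt0.
pose m := Num.truncn z; have /andP[mz zm] := truncn_itv (ltW z0).
have : Gamma m.+1%:R <= 1 * Gamma z + 1 * Gamma (z + 1).
  apply: Gamma_le => // x x0; rewrite !mul1r.
  have m1 : m.+1%:R <= z + 1 by rewrite -natr1 lerD2r.
  have [x1|x1] := leP x 1.
    apply: (@le_trans _ _ (x `^ (z - 1))); last by rewrite lerDl powR_ge0.
    by rewrite ger_powR ?x0// lerD2r ltW.
  apply: (@le_trans _ _ (x `^ (z + 1 - 1))); last by rewrite lerDr powR_ge0.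
  by rewrite ler_powR ?(ltW x1)// lerD2r.
rewrite Gamma_nat !mul1r GammaD1// -[X in X + _]mul1r -mulrDl.
move=> h; have : 0 < (1 + z) * Gamma z.
  by rewrite (lt_le_trans _ h)// ltr0n fact_gt0.
by rewrite pmulr_rgt0// addr_gt0.
Qed.

(** Wendel's inequality. The affine bound on (t/x)^a, multiplied by x^a t^(x-1), integrates to (1 -
    a) x^a Gamma(x) + a x^(a-1) Gamma(x + 1), and the two terms add up to x^a Gamma(x). *)
Lemma GammaD_le x a : 0 < x -> 0 <= a <= 1 -> Gamma (x + a) <= x `^ a * Gamma x.
Proof.
move=> x0 /andP[a0 a1].
have xa : 0 < x + a by rewrite ltr_pwDl.
have x1 : 0 < x + 1 by rewrite addr_gt0.
have -> : x `^ a * Gamma x =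
    x `^ a * (1 - a) * Gamma x + x `^ a * a / x * Gamma (x + 1).
  by rewrite GammaD1//; field; rewrite gt_eqF.
apply: Gamma_le => //.
- by rewrite mulr_ge0 ?powR_ge0 ?subr_ge0.
- by rewrite divr_ge0 ?mulr_ge0 ?powR_ge0// ltW.
move=> t t0.
have tn : t != 0 by rewrite gt_eqF.
have -> : x + a - 1 = (x - 1) + a by ring.
have -> : x + 1 - 1 = (x - 1) + 1 by ring.
rewrite !(@powRD _ t (x - 1)) ?tn ?implybT// powRr1; last exact: ltW.
have -> : t `^ a = x `^ a * (t / x) `^ a.
  by rewrite -powRM ?divr_ge0 ?ltW// mulrCA divff ?mulr1 ?gt_eqF.
have h := @powR_le_affine R a (t / x).
have {}h : (t / x) `^ a <= 1 - a + a * (t / x) by rewrite h ?a0// divr_gt0.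
apply: (@le_trans _ _ (t `^ (x - 1) * x `^ a * (1 - a + a * (t / x)))).
  by rewrite mulrA ler_wpM2l ?mulr_ge0 ?powR_ge0.
by rewrite le_eqVlt; apply/orP; left; apply/eqP; field; rewrite gt_eqF.
Qed.

Lemma cvg_Gamma_ratio a : 0 <= a ->
  Gamma (x + a) / (Gamma x * x `^ a) @[x --> +oo] --> (1 : R).
Proof.
have base (b : R) : 0 <= b <= 1 ->
    Gamma (x + b) / (Gamma x * x `^ b) @[x --> +oo] --> (1 : R).
  move=> /[dup] b01 /andP[b0 b1].
  apply: (@squeeze_cvgr _ _ _ _ (fun x => (x / (x + b)) `^ (1 - b)) (fun=> 1)).
  - near=> x.
    have x0 : 0 < x by [].
    have xb : 0 < x + b by rewrite ltr_pwDl.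
    have xn : x != 0 by rewrite gt_eqF.
    have G0 : 0 < Gamma x * x `^ b by rewrite mulr_gt0 ?Gamma_gt0 ?powR_gt0.
    rewrite ler_pdivlMr// ler_pdivrMr// mul1r.
    rewrite (mulrC (Gamma x)) GammaD_le ?b01// andbT.
    (* The lower bound is the same inequality started at x + b: x Gamma(x) = Gamma(x + 1) <= (x +
       b)^(1-b) Gamma(x + b). *)
    have := @GammaD_le (x + b) (1 - b) xb.
    rewrite -addrA [b + _]addrC subrK subr_ge0 b1 lerBlDr lerDl b0 => /(_ isT).
    rewrite GammaD1// => h.
    have xE : x `^ (1 - b) * x `^ b = x.
      by rewrite -powRD ?xn ?implybT// subrK powRr1// ltW.
    have VE : (x + b)^-1 `^ (1 - b) * (x + b) `^ (1 - b) = 1.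
      by rewrite -powRM ?invr_ge0 ?ltW// mulVf ?powR1// gt_eqF.
    have -> : (x / (x + b)) `^ (1 - b) * (x `^ b * Gamma x) =
        (x + b)^-1 `^ (1 - b) * (x * Gamma x).
      by rewrite powRM ?invr_ge0 ?ltW// mulrACA xE mulrCA.
    have -> : Gamma (x + b) =
        (x + b)^-1 `^ (1 - b) * ((x + b) `^ (1 - b) * Gamma (x + b)).
      by rewrite mulrA VE mul1r.
    by rewrite ler_wpM2l// powR_ge0.
  - suff : (x / (x + b)) `^ (1 - b) @[x --> +oo] --> (1 : R) `^ (1 - b).
      by rewrite powR1.
    apply: (@cvg_comp _ _ _ (fun x => x / (x + b)) (fun y => y `^ (1 - b))
      _ (nbhs (1 : R))); last exact: continuous_powR_gt0.
    have : (1 + b / x)^-1 @[x --> +oo] --> (1 : R)^-1.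
      by apply: cvgV; [exact: oner_neq0|exact: cvg_1D_divr].
    rewrite invr1; apply: cvg_trans; apply: near_eq_cvg; near=> x.
    have x0 : 0 < x by [].
    have -> : 1 + b / x = (x + b) / x by rewrite mulrDl divff// gt_eqF.
    by rewrite invf_div.
  - exact: cvg_cst.
have step (b : R) : 0 < b ->
    Gamma (x + b) / (Gamma x * x `^ b) @[x --> +oo] --> (1 : R) ->
    Gamma (x + (b + 1)) / (Gamma x * x `^ (b + 1)) @[x --> +oo] --> (1 : R).
  move=> b0 h.
  have : (1 + b / x) * (Gamma (x + b) / (Gamma x * x `^ b)) @[x --> +oo]
      --> (1 : R) * 1.
    by apply: cvgM; [exact: cvg_1D_divr|exact: h].
  rewrite mul1r; apply: cvg_trans; apply: near_eq_cvg; near=> x.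
  have x0 : 0 < x by [].
  have xn : x != 0 by rewrite gt_eqF.
  have G0 : Gamma x != 0 by rewrite gt_eqF// Gamma_gt0.
  have P0 : x `^ b != 0 by rewrite gt_eqF// powR_gt0.
  rewrite addrA GammaD1 ?addr_gt0// powRD ?xn ?implybT// powRr1 ?ltW//=.
  by field; rewrite xn G0 P0.
move=> a0; have /andP[na an] := truncn_itv a0.
move: na an; move: (Num.truncn a) => n; elim: n a a0 => [|n IH] a a0 na an.
  by apply: base; rewrite a0 ltW.
(* Setting a <= 1 aside leaves a - 1 strictly positive, as [step] demands. *)
have [a1|a1] := leP a 1; first by apply: base; rewrite a0.
have -> : a = (a - 1) + 1 by rewrite subrK.
apply: step; first by rewrite subr_gt0.
apply: IH; first by rewrite subr_ge0 ltW.
  by rewrite lerBrDr natr1.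
by rewrite ltrBlDr natr1.
Unshelve. all: by end_near. Qed.
End gamma_function.

(** A finite total with one finite summand forces the other to be finite, so an unknown integral can
    be solved for without proving integrability first. *)
Lemma adde_EFinE (R : realType) (x : \bar R) (a b : R) :
  (x + a%:E = b%:E -> x = (b - a)%:E)%E.
Proof. by case: x => [r| |]//=; rewrite -EFinD => -[<-]; rewrite addrK. Qed.

(* Otherwise unification unfolds [Gamma] to an integral and does not return. *)
#[local] Opaque Defs.Gamma.

(** * Moments of the reciprocal of a Pareto variable *)

Section pareto_moments.
Variables (R : realType) (d : measure_display) (T : measurableType d).
Variables (P : probability T R) (Z : T -> R) (k : R).
Hypothesis k_gt0 : 0 < k.
Hypothesis mZ : measurable_fun setT (Z : T -> measurableTypeR R).
Hypothesis Z_tail : forall z, 1 <= z -> P [set e | z < Z e] = (z `^ (- k))%:E.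
Notation mu := (@lebesgue_measure R).
Local Notation Gamma := (@Gamma R).

(* The reciprocal of [Z], truncated off the null set [Z <= 1]. *)
Let W e : R := (Num.max (Z e) 1)^-1.

Let W_gt0 e : 0 < W e.
Proof. by rewrite invr_gt0 lt_max ltr01 orbT. Qed.

Let W_le1 e : W e <= 1.
Proof. by rewrite invf_le1 ?le_max ?lexx ?orbT// lt_max ltr01 orbT. Qed.

Let measurable_W : measurable_fun setT W.
Proof.
have -> : W = (fun x => x `^ (-1)) \o (fun e => Num.max (Z e) 1).
  apply/funext => e /=; rewrite powR_inv1// le_max ler01 orbT//.
apply: (@measurableT_comp _ _ _ _ _ _ (fun x : R => x `^ (-1))).
  exact: measurable_powR.
by apply: measurable_maxr => //; exact: mZ.
Qed.

Let measurable_moment b m : measurable_fun setT (fun e => W e `^ b * (1 - W e) ^+ m).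
Proof.
apply: measurable_funM.
  by apply: (@measurableT_comp _ _ _ _ _ _ (fun x : R => x `^ b)) => //;
  exact: measurable_powR.
by apply: measurable_funX; exact: measurable_funB.
Qed.

(** The absolute value changes nothing on [0, 1] and makes integrand and primitive continuous from
    both sides at the endpoint 1. *)
Let integral_onem_powR (c : R) : 0 < c ->
  (\int[mu]_(x in `[0%R, 1%R]) (`|1 - x| `^ c)%:E = ((c + 1)^-1)%:E)%E.
Proof.
move=> c0; have c10 : 0 < c + 1 by rewrite addr_gt0.
have cont (b : R) : 0 < b -> continuous (fun x : R => `|1 - x| `^ b).
  move=> b0 x; apply: (@continuous_comp _ _ _ (fun x : R => 1 - x) (fun x => `|x| `^ b)).
    by apply: cvgB; [exact: cvg_cst|exact: cvg_id].
  exact: continuous_norm_powR.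
have contF : continuous (fun x : R => - (c + 1)^-1 * `|1 - x| `^ (c + 1)).
  by move=> x; apply: cvgM; [exact: cvg_cst|exact: cont].
have dF (x : R) : x \in `]0, 1[ -> is_derive x 1
    (fun x : R => - (c + 1)^-1 * `|1 - x| `^ (c + 1)) (`|1 - x| `^ c).
  rewrite in_itv/= => /andP[x0 x1]; have y0 : 0 < 1 - x by rewrite subr_gt0.
  apply: (@near_eq_is_derive _ _ _
    (fun x : R => - (c + 1)^-1 * (1 - x) `^ (c + 1))) => //.
    near=> y; rewrite ger0_norm// subr_ge0 ltW//.
    by near: y; exact: lt_nbhsl.
  have h : is_derive (1 - x) 1 (fun y : R => y `^ (c + 1)) ((c + 1) * (1 - x) `^ c).
    have := is_derive1_powR (c + 1) y0; rewrite addrK; exact.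
  have h1 : is_derive x 1 (fun y : R => 1 - y) (-1).
    by rewrite -sub0r; exact: is_deriveB.
  have h2 := @is_derive1_comp _ _ (fun y : R => 1 - y) _ _ _ h h1.
  have h3 := @is_deriveZ _ _ _ _ (- (c + 1)^-1) _ _ _ h2.
  apply: is_derive_eq.
  rewrite /GRing.scale/= ger0_norm ?(ltW y0)//.
  by field; rewrite gt_eqF.
rewrite (@continuous_FTC2 _ _ (fun x : R => - (c + 1)^-1 * `|1 - x| `^ (c + 1)))//.
- rewrite subrr normr0 powR0 ?gt_eqF// mulr0 subr0 normr1 powR1 mulr1.
  by rewrite sub0e -EFinN opprK.
- exact/continuous_subspaceT/cont.
- split; first by move=> x /dF.
  + by apply/cvg_at_right_filter; exact: contF.
  + by apply/cvg_at_left_filter; exact: contF.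
- by move=> x /dF dx; rewrite derive1E derive_val.
Unshelve. all: by end_near. Qed.

(** Layer-cake formula for Y = 1 - W^b: P(Y > r) = P(Z > (1 - r)^(-1/b)) = (1 - r)^(k/b) on [0, 1[,
    so E[Y] = b/(k + b). Passing to 1 - W^b yields events of the form z < Z, the only ones whose
    probability is given. *)
Let integral_powR (b : R) : 0 < b ->
  (\int[P]_e (W e `^ b)%:E = (k / (k + b))%:E)%E.
Proof.
move=> b0; have kb : 0 < k + b by rewrite addr_gt0.
have c0 : 0 < k / b by rewrite divr_gt0.
have Wb1 e : W e `^ b <= 1.
  have := @ge0_ler_powR R b (ltW b0) (W e) 1.
  by rewrite !nnegrE powR1 ler01 ltW//; apply.
have mWb : measurable_fun setT (fun e => W e `^ b).
  by apply: (@measurableT_comp _ _ _ _ _ _ (fun x : R => x `^ b)) => //;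
  exact: measurable_powR.
have mY : measurable_fun setT (fun e => 1 - W e `^ b) by exact: measurable_funB.
pose Y : {RV P >-> R} :=
  HB.pack (fun e => 1 - W e `^ b) (isMeasurableFun.Build _ _ _ _ _ mY).
have EY : (\int[P]_e (1 - W e `^ b)%:E = (b / (k + b))%:E)%E.
  have := @ge0_expectation_ccdf _ _ _ P Y.
  rewrite expectation_def => -> /=; last by move=> e; rewrite subr_ge0.
  have Ytail r : 0 <= r ->
      ccdf Y r = (if r <= 1 then `|1 - r| `^ (k / b) else 0)%:E.
    move=> r0; rewrite /ccdf /distribution /pushforward.
    have [r1|r1] := ltP r 1.
      have r10 : 0 < 1 - r by rewrite subr_gt0.
      pose z := (1 - r) `^ (- b^-1).
      have z1 : 1 <= z.
        rewrite /z powRN invf_ge1 ?powR_gt0//.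
        have := @ge0_ler_powR R b^-1 _ (1 - r) 1.
        rewrite !nnegrE powR1 ler01 invr_ge0 ltW// ltW// lerBlDr lerDl; exact.
      have -> : [set` `]r, +oo[] = [set x | r < x].
        by apply/seteqP; split => x /=; rewrite in_itv/= andbT.
      have -> : Y @^-1` [set x | r < x] = [set e | z < Z e].
        have zE : 1 - r = z^-1 `^ b.
          by rewrite /z powRN invrK -powRrM mulVf ?gt_eqF// powRr1// ltW.
        have z0 : 0 < z by rewrite (lt_le_trans _ z1).
        have We e : (r < 1 - W e `^ b) = (z < Z e).
          have zn : z^-1 \is Num.nneg by rewrite nnegrE invr_ge0 ltW.
          have Wn : W e \is Num.nneg by rewrite nnegrE; exact/ltW/W_gt0.
          rewrite ltrBrDl -ltrBrDr zE; transitivity (W e < z^-1).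
            have [/(ge0_ler_powR (ltW b0)) h|h] := leP z^-1 (W e).
              by apply/negbTE; rewrite -leNgt h.
            by rewrite gt0_ltr_powR.
          (* As z >= 1, the condition z < max(Z, 1) reduces to z < Z. *)
          rewrite ltf_pV2 ?posrE ?lt_max ?ltr01 ?orbT//.
          by rewrite [z < 1]ltNge z1 orbF.
        by apply/seteqP; split => e /=; rewrite We.
      rewrite Z_tail// (ltW r1) /z -powRrM mulrNN ger0_norm ?(ltW r10)//.
      by rewrite mulrC.
    have -> : Y @^-1` `]r, +oo[ = set0.
      apply/seteqP; split => e //=; rewrite in_itv/= andbT ltrBrDr -ltrBrDl => h.
      have := lt_le_trans h (_ : 1 - r <= 0); rewrite subr_le0 => /(_ r1).
      by rewrite ltNge powR_ge0.
    rewrite measure0; case: ifPn => // r1'; have -> : r = 1 by apply/le_anti/andP.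
    by rewrite subrr normr0 powR0// gt_eqF.
  rewrite (_ : `[0%R, +oo[%classic = `[0%R, 1%R] `|` `]1%R, +oo[); last first.
    apply/seteqP; split => x /=; rewrite !in_itv/= !andbT.
      by move=> x0; rewrite x0 /=; have [|] := leP x 1; [left|right].
    by move=> [/andP[]//|/ltW]; apply: le_trans.
  have mccdf : measurable_fun setT (ccdf Y) by exact: ccdf_measurable.
  rewrite ge0_integral_setU//=.
  - rewrite [X in (_ + X)%E]integral0_eq ?adde0; last first.
      move=> x /=; rewrite in_itv/= andbT => x1.
      by rewrite Ytail ?(le_trans _ (ltW x1))// leNgt x1.
    transitivity (\int[mu]_(x in `[0%R, 1%R]) (`|1 - x| `^ (k / b))%:E)%E.
      apply: eq_integral => x; rewrite inE/= in_itv/= => /andP[x0 x1].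
      by rewrite Ytail// x1.
    rewrite integral_onem_powR//; congr EFin.
    have -> : k / b + 1 = (k + b) / b by rewrite mulrDl divff// gt_eqF.
    by rewrite invf_div.
  - exact: measurable_funTS.
  - apply/disj_setPLR => x /=; rewrite !in_itv/= andbT => /andP[_ x1].
    by apply/negP; rewrite -leNgt.
have : (\int[P]_e (W e `^ b)%:E + \int[P]_e (1 - W e `^ b)%:E = 1)%E.
  rewrite -ge0_integralD//.
  - under eq_integral do rewrite -EFinD addrC subrK.
    by rewrite integral_cst// mul1e; exact: probability_setT.
  - by move=> e _; rewrite lee_fin powR_ge0.
  - exact/measurable_EFinP.
  - by move=> e _; rewrite lee_fin subr_ge0.
  - exact/measurable_EFinP.
rewrite EY => /adde_EFinE ->; congr EFin.
by field; rewrite gt_eqF.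
Qed.

(** Since W^b (1 - W)^m splits as W^b (1 - W)^(m+1) + W^(b+1) (1 - W)^m, the moment at m + 1 is a
    difference of two moments at m; the induction therefore keeps b general. *)
Lemma pareto_beta_integral (b : R) m : 0 < b ->
  (\int[P]_e ((Num.max (Z e) 1)^-1 `^ b * (1 - (Num.max (Z e) 1)^-1) ^+ m)%:E =
   (k * Gamma m.+1%:R * Gamma (k + b) / Gamma (k + b + m.+1%:R))%:E)%E.
Proof.
have pos b' m' e : (0 <= (W e `^ b' * (1 - W e) ^+ m')%:E)%E.
  by rewrite lee_fin mulr_ge0 ?powR_ge0 ?exprn_ge0// subr_ge0.
elim: m b => [|m IH] b b0; have kb : 0 < k + b by rewrite addr_gt0.
  under eq_integral do rewrite expr0 mulr1.
  rewrite integral_powR// Gamma1 GammaD1//; congr EFin; field.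
  by rewrite !gt_eqF// Gamma_gt0.
have b10 : 0 < b + 1 by rewrite addr_gt0.
have := IH (b + 1) b10; have := IH b b0.
have : (\int[P]_e (W e `^ b * (1 - W e) ^+ m)%:E =
  \int[P]_e (W e `^ b * (1 - W e) ^+ m.+1)%:E +
  \int[P]_e (W e `^ (b + 1) * (1 - W e) ^+ m)%:E)%E.
  rewrite -ge0_integralD//.
  - apply: eq_integral => e _; rewrite -EFinD; congr EFin.
    rewrite powRD ?gt_eqF ?implybT// powRr1 ?ltW// exprS.
    by ring.
  - by apply/measurable_EFinP; exact: measurable_moment.
  - by apply/measurable_EFinP; exact: measurable_moment.
rewrite /W => -> E1 E2; move: E1; rewrite E2 => /adde_EFinE ->; congr EFin.
have n0 : 0 < m.+1%:R :> R by rewrite ltr0n.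
rewrite -(natr1 m.+1); move: (m.+1%:R) n0 => n n0.
rewrite (_ : k + (b + 1) + n = k + b + n + 1); last by ring.
rewrite !addrA; move: (k + b) kb => c kb; rewrite !GammaD1// ?addr_gt0//.
have : Gamma (c + n) != 0 by rewrite gt_eqF// Gamma_gt0// addr_gt0.
have : c + n != 0 by rewrite gt_eqF// addr_gt0.
move: (Gamma n) (Gamma c) (Gamma (c + n)) => x y z h1 h2.
by field; rewrite h1 h2.
Qed.
End pareto_moments.

(** Writes 1/x as x (x^2)^(-1), a product involving a power function; at 0 both sides are 0 by
    convention. *)
Lemma measurable_invr (R : realType) : measurable_fun setT (fun x : R => x^-1).
Proof.
have -> : (fun x : R => x^-1) = (fun x => x * (x ^+ 2) `^ (-1)).
  apply/funext => x; rewrite powR_inv1 ?sqr_ge0//.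
  have [->|x0] := eqVneq x 0; first by rewrite invr0 mul0r.
  by rewrite expr2 invfM mulrA divff// mul1r.
apply: measurable_funM => //.
apply: (@measurableT_comp _ _ _ _ _ _ (fun x : R => x `^ (-1))).
  exact: measurable_powR.
exact: measurable_funX.
Qed.

(** * Two negative binomial variables mixed over a common success probability *)

Section negbin_mixture.
Variables (R : realType) (dZ dT dT' : measure_display).
Variables (EZ : measurableType dZ) (ET : measurableType dT).
Variables (ET' : measurableType dT') (PZ : probability EZ R).
Variables (PT : probability ET R) (PT' : probability ET' R).
Variables (Z : EZ -> R) (T : R -> R -> ET -> nat) (T' : R -> R -> ET' -> nat).
Variable k : R.
Hypothesis k_gt0 : 0 < k.
Hypothesis mZ : measurable_fun setT (Z : EZ -> measurableTypeR R).
Hypothesis Z_tail : forall z, 1 <= z -> PZ [set e | z < Z e] = (z `^ (- k))%:E.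
Hypothesis hT : negbin_family PT T.
Hypothesis hT' : negbin_family PT' T'.
Local Notation Gamma := (@Gamma R).

(** Joint measurability in q and the sample point passes to sections and to their measures; this
    allows q to be replaced by a function of Z and integrated. *)
Lemma negbin_section_measurable (d : measure_display) (E : measurableType d)
  (Q : probability E R) (S : R -> R -> E -> nat) (delta : R) (i : nat) :
  negbin_family Q S -> 0 < delta ->
  (forall q, measurable [set e | S delta q e = i]) /\
  measurable_fun setT (fun q => Q [set e | S delta q e = i]).
Proof.
move=> hS delta0; have [mS _] := hS delta delta0.
pose A : set (measurableTypeR R * E) := [set x | S delta x.1 x.2 = i].
have mA : measurable A.
  have := mS measurableT [set i]; rewrite setTI; exact.
have xA q : xsection A q = [set e | S delta q e = i].
  by apply/seteqP; split => e; rewrite /xsection/= inE.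
split=> [q|]; first by rewrite -xA; exact: measurable_xsection.
have := measurable_fun_xsection Q mA; congr (measurable_fun _ _).
by apply/funext => q /=; rewrite xA.
Qed.

(** Given Z, the product measure factorizes, and since both factors have q = 1/Z the powers merge
    into q^(delta + delta') (1 - q)^(i + j), a moment computed by [pareto_beta_integral]. *)
Lemma negbin_mixture (delta delta' : R) (i j : nat) : 0 < delta -> 0 < delta' ->
  (PZ \x (PT \x PT'))%E [set e | T delta (Z e.1)^-1 e.2.1 = i /\
                                 T' delta' (Z e.1 `^ (- 1)) e.2.2 = j] =
  (Gamma (i%:R + delta) / (Gamma delta * Gamma (i%:R + 1)) *
   (Gamma (j%:R + delta') / (Gamma delta' * Gamma (j%:R + 1))) *
   (k * Gamma (i + j).+1%:R * Gamma (k + (delta + delta')) /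
    Gamma (k + (delta + delta') + (i + j).+1%:R)))%:E.
Proof.
move=> d0 d0'.
have [mA mPA] := negbin_section_measurable i hT d0.
have [mB mPB] := negbin_section_measurable j hT' d0'.
pose c := Gamma (i%:R + delta) / (Gamma delta * Gamma (i%:R + 1)).
pose c' := Gamma (j%:R + delta') / (Gamma delta' * Gamma (j%:R + 1)).
have c0 : 0 <= c by rewrite divr_ge0 ?mulr_ge0// ltW// Gamma_gt0// ltr_wpDl.
have c0' : 0 <= c' by rewrite divr_ge0 ?mulr_ge0// ltW// Gamma_gt0// ltr_wpDl.
pose W e : R := (Num.max (Z e) 1)^-1.
pose f e : R := W e `^ (delta + delta') * (1 - W e) ^+ (i + j).
have mW : measurable_fun setT W.
  apply: (@measurableT_comp _ _ _ _ _ _ (fun x : R => x^-1)).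
    exact: measurable_invr.
  by apply: measurable_maxr => //; exact: mZ.
have mf : measurable_fun setT f.
  apply: measurable_funM.
    by apply: (@measurableT_comp _ _ _ _ _ _ (fun x : R => x `^ _)) => //;
       exact: measurable_powR.
  by apply: measurable_funX; exact: measurable_funB.
have f0 e : 0 <= f e.
  rewrite mulr_ge0 ?powR_ge0 ?exprn_ge0// subr_ge0.
  by rewrite invf_le1 ?le_max ?lexx ?orbT// lt_max ltr01 orbT.
transitivity (\int[PZ]_e (PT [set t | T delta (Z e)^-1 t = i] *
                          PT' [set t | T' delta' (Z e `^ (-1)) t = j]))%E.
  rewrite /product_measure1; apply: eq_integral => e _ /=.
  rewrite (_ : xsection _ e = [set t | T delta (Z e)^-1 t = i] `*`
                            [set t | T' delta' (Z e `^ (-1)) t = j]); last first.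
    by apply/seteqP; split => -[t t']; rewrite /xsection/= inE.
  exact: product_measure1E.
transitivity (\int[PZ]_e ((c * c')%:E * (f e)%:E))%E.
  (* The mass function is prescribed only for 0 < q < 1, that is Z > 1; the tail at z = 1 equals 1,
     so the remaining set is null. *)
  apply: ae_eq_integral => //.
  - apply: emeasurable_funM.
      apply: (measurableT_comp mPA).
      by apply: (@measurableT_comp _ _ _ _ _ _ (fun x : R => x^-1)) => //;
         exact: measurable_invr.
    apply: (measurableT_comp mPB).
    by apply: (@measurableT_comp _ _ _ _ _ _ (fun x : R => x `^ _)) => //;
       exact: measurable_powR.
  - apply/measurable_EFinP; exact: measurable_funM.
  have mZ1 : measurable [set e | 1 < Z e].
    rewrite -[X in measurable X]setTI.
    have -> : [set e | 1 < Z e] = Z @^-1` `]1, +oo[.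
      by apply/seteqP; split => e /=; rewrite in_itv/= andbT.
    exact: mZ.
  exists (~` [set e | 1 < Z e]); split.
  - exact: measurableC.
  - have := probability_setC PZ mZ1; rewrite Z_tail// powR1 subee//; exact.
  move=> e /= h1 h2; apply: h1 => _.
  have Z0 : 0 < Z e by rewrite (lt_trans _ h2).
  have q01 : 0 < (Z e)^-1 < 1 by rewrite invr_gt0 Z0 invf_lt1.
  rewrite powR_inv1 ?(ltW Z0)// (hT d0).2// (hT' d0').2//.
  rewrite -!EFinM; congr EFin; rewrite /negbin_pmf /f /W.
  have -> : Num.max (Z e) 1 = Z e by apply/max_idPl/ltW.
  rewrite powRD ?exprD; last by rewrite invr_eq0 (gt_eqF Z0) implybT.
  rewrite -/c -/c'; ring.
rewrite ge0_integralZl//.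
- by rewrite (pareto_beta_integral k_gt0 mZ Z_tail) ?addr_gt0// -EFinM.
- exact/measurable_EFinP.
- by move=> e _; rewrite lee_fin.
- by rewrite lee_fin mulr_ge0.
Qed.
End negbin_mixture.

(** * Closed form of the joint mass function *)

Definition pa_mass (R : realType) (lambda mu s a b : R) (i j : nat) : R :=
  Gamma (i%:R + lambda) / Gamma (i%:R + 1) * (Gamma (j%:R + mu) / Gamma (j%:R + 1))
  * (Gamma (i%:R + j%:R) / Gamma (i%:R + j%:R + s)) * (a * i%:R + b * j%:R).

(** Conditioning on B leaves two mixtures, one with i lowered by 1 and lambda raised by 1, the other
    likewise in j and mu. The shifts cancel in Gamma(i + lambda), while 1/Gamma(i) = i/Gamma(i + 1)
    creates the linear factor i, respectively j. *)
Lemma mixture_pa_mass (R : realType) (alpha beta gamma lambda mu : R)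
  (p : nat -> nat -> R) :
  pa_params alpha beta gamma lambda mu ->
  mixture_representation alpha beta gamma lambda mu p ->
  c1 alpha beta gamma lambda = c2 alpha beta gamma mu ->
  let k := 1 / c1 alpha beta gamma lambda in
  let s := 1 + k + lambda + mu in
  forall i j, (0 < i + j)%N -> p i j =
    pa_mass lambda mu s
      (gamma / (alpha + gamma) * (k * Gamma s / (Gamma (lambda + 1) * Gamma mu)))
      (alpha / (alpha + gamma) * (k * Gamma s / (Gamma lambda * Gamma (mu + 1)))) i j.
Proof.
move=> [/andP[al0 al1] /andP[be0 be1] /andP[ga0 ga1] abg [la0 mu0]] hrep c12 k s i j ij.
have ag0 : 0 < alpha + gamma by rewrite addr_gt0.
have c10 : 0 < c1 alpha beta gamma lambda.
  by rewrite divr_gt0 ?addr_gt0 ?mulr_gt0.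
have k0 : 0 < k by rewrite divr_gt0.
case: hrep => dB [dZ [dT [dT' [EB [EZ [ET [ET']]]]]]].
move=> [PB [PZ [PT [PT' [B [Z [T [T' []]]]]]]]].
move=> [mB hB] [mZ hZ] hT hT' /(_ i j); rewrite -c12 divff ?gt_eqF//= => hp.
apply: EFin_inj; rewrite -hp.
pose S1 := [set e : EZ * (ET * ET') | (1 + T (lambda + 1)%R (Z e.1)^-1 e.2.1)%N = i /\
   T' mu (Z e.1 `^ (- 1)) e.2.2 = j].
pose S2 := [set e : EZ * (ET * ET') | T lambda (Z e.1)^-1 e.2.1 = i /\
   (1 + T' (mu + 1)%R (Z e.1 `^ (- 1)) e.2.2)%N = j].
pose G := Gamma (i%:R + lambda) / Gamma (i%:R + 1) *
  (Gamma (j%:R + mu) / Gamma (j%:R + 1)) *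
  (Gamma (i%:R + j%:R) / Gamma (i%:R + j%:R + s)).
have massE a b : pa_mass lambda mu s a b i j = G * (a * i%:R + b * j%:R) by [].
have la10 : 0 < lambda + 1 by rewrite addr_gt0.
have mu10 : 0 < mu + 1 by rewrite addr_gt0.
have s0 : 0 < s by rewrite !addr_gt0.
have sE : s = 1 + k + lambda + mu by [].
clearbody s.
have ijn : i%:R + j%:R = (i + j).-1.+1%:R :> R by rewrite -natrD prednK.
have nz (z : R) : 0 < z -> Gamma z != 0 by move=> z0; rewrite gt_eqF// Gamma_gt0.
(* In [alg] the product n g is Gamma(i + 1) with n = i, and n moves to the linear factor; [alg']
   does the same for j. *)
have alg (x L n g y M h u S V : R) : L != 0 -> g != 0 -> M != 0 -> h != 0 ->
    V != 0 -> n != 0 -> x / (L * g) * (y / (M * h)) * (k * u * S / V) =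
    x / (n * g) * (y / h) * (u / V) * (k * S / (L * M) * n).
  by move=> L0 g0 M0 h0 V0 n0; field; rewrite L0 g0 M0 h0 V0 n0.
have alg' (x L n g y M h u S V : R) : L != 0 -> g != 0 -> M != 0 -> h != 0 ->
    V != 0 -> n != 0 -> x / (L * g) * (y / (M * h)) * (k * u * S / V) =
    x / g * (y / (n * h)) * (u / V) * (k * S / (L * M) * n).
  by move=> L0 g0 M0 h0 V0 n0; field; rewrite L0 g0 M0 h0 V0 n0.
have E1 : (PZ \x (PT \x PT'))%E S1 =
    (G * (k * Gamma s / (Gamma (lambda + 1) * Gamma mu) * i%:R))%:E.
  (* For i = 0 the event is empty and the right-hand side carries the factor 0. *)
  rewrite /G ijn; case: i @G @S1 @S2 ij ijn {hp massE} => [|i] ? S1 S2 ij ijn.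
    rewrite (_ : S1 = set0); last by apply/seteqP; split => // e [].
    rewrite !mulr0 /product_measure1; apply: integral0_eq => e _.
    rewrite [LHS]/comp xsection0; apply: integral0_eq => t _.
    by rewrite [LHS]/comp xsection0; exact: measure0.
  rewrite (_ : S1 = [set e | T (lambda + 1) (Z e.1)^-1 e.2.1 = i /\
      T' mu (Z e.1 `^ (- 1)) e.2.2 = j]); last first.
    by apply/seteqP; split => e /= [h1 h2]; split => //; [case: h1|rewrite h1].
  rewrite (negbin_mixture k0 mZ hZ hT hT')//; congr EFin.
  have i0 : 0 < i%:R + 1 :> R by rewrite natr1 ltr0n.
  rewrite -(natr1 i) (GammaD1 i0) addSn/= -(addrA i%:R) (addrC 1 lambda).
  rewrite (_ : k + (lambda + 1 + mu) = s); last by rewrite sE; ring.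
  rewrite (addrC s); apply: alg; by rewrite ?nz// ?ltr_wpDl// gt_eqF.
have E2 : (PZ \x (PT \x PT'))%E S2 =
    (G * (k * Gamma s / (Gamma lambda * Gamma (mu + 1)) * j%:R))%:E.
  rewrite /G ijn; case: j @G @S1 @S2 ij ijn {hp massE E1} => [|j] ? S1 S2 ij ijn.
    rewrite (_ : S2 = set0); last by apply/seteqP; split => // e [].
    rewrite !mulr0 /product_measure1; apply: integral0_eq => e _.
    rewrite [LHS]/comp xsection0; apply: integral0_eq => t _.
    by rewrite [LHS]/comp xsection0; exact: measure0.
  rewrite (_ : S2 = [set e | T lambda (Z e.1)^-1 e.2.1 = i /\
      T' (mu + 1) (Z e.1 `^ (- 1)) e.2.2 = j]); last first.
    by apply/seteqP; split => e /= [h1 h2]; split => //; [case: h2|rewrite h2].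
  rewrite (negbin_mixture k0 mZ hZ hT hT')//; congr EFin.
  have j0 : 0 < j%:R + 1 :> R by rewrite natr1 ltr0n.
  rewrite -(natr1 j) (GammaD1 j0) addnS/= -(addrA j%:R) (addrC 1 mu).
  rewrite (_ : k + (lambda + (mu + 1)) = s); last by rewrite sE; ring.
  rewrite (addrC s); apply: alg'; by rewrite ?nz// ?ltr_wpDl// gt_eqF.
set x1 := G * _ in E1; set x2 := G * _ in E2.
have x10 : 0 <= x1.
  rewrite -lee_fin -E1; apply: integral_ge0 => e _; apply: integral_ge0 => t _.
  exact: measure_ge0.
have x20 : 0 <= x2.
  rewrite -lee_fin -E2; apply: integral_ge0 => e _; apply: integral_ge0 => t _.
  exact: measure_ge0.
have mBt : measurable [set e | B e].
  have := mB measurableT [set true]; rewrite setTI; exact.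
have mBf : measurable (~` [set e | B e]) by exact: measurableC.
(* The section of the event is [S1] where B holds and [S2] elsewhere, so the outer integrand takes
   only the values x1 and x2. *)
transitivity (\int[PB]_e (x1%:E * (\1_[set e | B e] e)%:E +
                          x2%:E * (\1_(~` [set e | B e]) e)%:E))%E.
  rewrite {1}/product_measure1; apply: eq_integral => e _; rewrite [LHS]/comp.
  rewrite -!EFinM !indicE in_setC mem_setE (_ : (e \in B) = B e)//.
  have [Be|Be] := boolP (B e).
    rewrite (_ : xsection _ e = S1) ?E1 ?mulr1 ?mulr0 ?adde0//.
    by apply/seteqP; split => x; rewrite /xsection/= inE/= Be.
  rewrite (_ : xsection _ e = S2) ?E2 ?mulr1 ?mulr0 ?add0e//.
  by apply/seteqP; split => x; rewrite /xsection/= inE/= (negbTE Be).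

rewrite ge0_integralD//; last 4 first.
- by move=> e _; rewrite mule_ge0.
- by apply/measurable_EFinP; apply: measurable_funM.
- by move=> e _; rewrite mule_ge0.
- by apply/measurable_EFinP; apply: measurable_funM.
rewrite !ge0_integralZl// ?integral_indic// ?setIT; try exact/measurable_EFinP.
have hB' : PB [set e | B e] = (gamma / (alpha + gamma))%:E := hB.
have hBC : PB (~` [set e | B e]) = (1 - gamma / (alpha + gamma))%:E.
  by have := probability_setC PB mBt; rewrite hB'.
rewrite [X in (_ * X + _)%E]hB' [X in (_ + _ * X)%E]hBC.
rewrite -!EFinM -EFinD; congr EFin.
have -> : 1 - gamma / (alpha + gamma) = alpha / (alpha + gamma).
  by field; rewrite gt_eqF.
clear E1 E2 x10 x20; rewrite massE /x1 /x2 {x1 x2 massE}.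
move: G (k * Gamma s / _) (k * Gamma s / _) (gamma / _) (alpha / _) => g u v w w'.
ring.
Qed.

(** * The scaling limit along real t *)

Section pa_mass_limit.
Variable R : realType.
Implicit Types t x y : R.
Local Notation Gamma := (@Gamma R).

Lemma cvg_truncn_div x : 0 < x ->
  (Num.truncn (t * x))%:R / t @[t --> +oo] --> x.
Proof.
move=> x0.
have inv0 : t^-1 @[t --> +oo] --> (0 : R).
  have : (1 + 1 / t) - 1 @[t --> +oo] --> (1 : R) - 1.
    by apply: cvgB; [exact: cvg_1D_divr|exact: cvg_cst].
  rewrite subrr; apply: cvg_trans; apply: near_eq_cvg; apply: nearW => t /=.
  by rewrite addrC addKr mul1r.
apply: (@squeeze_cvgr _ _ _ _ (fun t => x - t^-1) (fun=> x)).
- near=> t; have t0 : 0 < t by [].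
  have tx0 : 0 <= t * x by rewrite mulr_ge0 ?ltW.
  have /andP[h1 h2] := truncn_itv tx0.
  rewrite ler_pdivlMr// ler_pdivrMr// mulrBl mulVf ?gt_eqF// [x * t]mulrC h1 andbT.
  by rewrite lerBlDr natr1 ltW.
- rewrite -[X in _ --> X]subr0; apply: cvgB => //; exact: cvg_cst.
- exact: cvg_cst.
Unshelve. all: by end_near. Qed.

Lemma cvg_truncn_pinfty x : 0 < x ->
  (Num.truncn (t * x))%:R @[t --> +oo] --> (+oo : set_system R).
Proof.
move=> x0; apply/cvgryPge => A; near=> t.
have : A + 1 <= t * x.
  by rewrite -ler_pdivrMr//; near: t; apply: nbhs_pinfty_ge; rewrite num_real.
have t0 : 0 < t by [].
have tx0 : 0 <= t * x by rewrite mulr_ge0 ?ltW.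
have /andP[_] := truncn_itv tx0; rewrite -natr1 => h1 h2.
by rewrite -(lerD2r 1) (le_trans h2)// ltW.
Unshelve. all: by end_near. Qed.

(** The error factor in Gamma(x + c) ~ x^c Gamma(x), which tends to 1. *)
Let gr c x := Gamma (x + c) / (Gamma x * x `^ c).

Let gr_neq0 c x : 0 < x -> 0 < c -> gr c x != 0.
Proof.
move=> x0 c0; rewrite gt_eqF// divr_gt0 ?mulr_gt0 ?Gamma_gt0 ?powR_gt0//.
exact: addr_gt0.
Qed.

Let grE c x : 0 < x -> 0 < c -> Gamma (x + c) = gr c x * (Gamma x * x `^ c).
Proof.
by move=> x0 c0; rewrite divfK// gt_eqF// mulr_gt0 ?Gamma_gt0 ?powR_gt0.
Qed.

(** Once each shifted Gamma is expressed through [gr], the unshifted ones cancel. What remains is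
    homogeneous of degree lambda + mu - 1 - s in the truncated arguments, hence after division a
    function of their ratios to t, which tend to x and y. *)
Lemma pa_mass_cvg (lambda mu s a b : R) x y :
  0 < lambda -> 0 < mu -> 0 < s -> 0 < x -> 0 < y ->
  pa_mass lambda mu s a b (Num.truncn (t * x)) (Num.truncn (t * y))
    / t `^ (lambda + mu - 1 - s) @[t --> +oo] -->
  x `^ (lambda - 1) * y `^ (mu - 1) * (x + y) `^ (- s) * (a * x + b * y).
Proof.
move=> la0 mu0 s0 x0 y0.
pose i t : R := (Num.truncn (t * x))%:R; pose j t : R := (Num.truncn (t * y))%:R.
have iy : i t @[t --> +oo] --> (+oo : set_system R) by exact: cvg_truncn_pinfty.
have jy : j t @[t --> +oo] --> +oo by exact: cvg_truncn_pinfty.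
have ijy : i t + j t @[t --> +oo] --> +oo.
  apply/cvgryPge => A; near=> t.
  have h1 : A <= i t by near: t; move/cvgryPge : iy; exact.
  by rewrite (le_trans h1)// lerDl ler0n.
have gr1 (c : R) (f : R -> R) : 0 < c -> f t @[t --> +oo] --> +oo ->
    gr c (f t) @[t --> +oo] --> (1 : R).
  move=> c0 fy; apply: (@cvg_comp _ _ _ f (gr c) _ (pinfty_nbhs R)) => //.
  by apply: cvg_Gamma_ratio; exact: ltW.
have u : i t / t @[t --> +oo] --> x by exact: cvg_truncn_div.
have v : j t / t @[t --> +oo] --> y by exact: cvg_truncn_div.
have pow (c z : R) (f : R -> R) : 0 < z -> f t @[t --> +oo] --> z ->
    f t `^ c @[t --> +oo] --> z `^ c.
  move=> z0 fz; apply: (@cvg_comp _ _ _ f (fun y => y `^ c) _ (nbhs z)) => //.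
  exact: continuous_powR_gt0.
have xy0 : 0 < x + y by rewrite addr_gt0.
have uv : i t / t + j t / t @[t --> +oo] --> x + y by exact: cvgD.
have lim : gr lambda (i t) * gr mu (j t) / gr s (i t + j t) *
   ((i t / t) `^ (lambda - 1) * (j t / t) `^ (mu - 1) *
    (i t / t + j t / t) `^ (- s) * (a * (i t / t) + b * (j t / t))) @[t --> +oo] -->
   1 * 1 / 1 * (x `^ (lambda - 1) * y `^ (mu - 1) * (x + y) `^ (- s) * (a * x + b * y)).
  apply: cvgM.
    apply: cvgM; first by apply: cvgM; exact: gr1.
    by apply: cvgV; [exact: oner_neq0|exact: gr1].
  apply: cvgM.
    apply: cvgM; last exact: pow.
    by apply: cvgM; exact: pow.
  by apply: cvgD; apply: cvgM => //; exact: cvg_cst.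
move: lim; rewrite mulr1 invr1 !mul1r; apply: cvg_trans; apply: near_eq_cvg.
near=> t.
have t0 : 0 < t by [].
have i0 : 0 < i t by near: t; move/cvgryPgt : iy; exact.
have j0 : 0 < j t by near: t; move/cvgryPgt : jy; exact.
rewrite /pa_mass -/(i t) -/(j t).
move: (i t) (j t) i0 j0 => m n m0 n0.
have mn0 : 0 < m + n by rewrite addr_gt0.
rewrite (grE m0 la0) (grE n0 mu0) (grE mn0 s0) !GammaD1//.
have nz (z c : R) : 0 < z -> (c == 0) ==> (z != 0).
  by move=> z0; rewrite (gt_eqF z0) implybT.
have pB (z c c' : R) : 0 < z -> z `^ (c - c') = z `^ c / z `^ c'.
  by move=> z0; rewrite powRD ?nz// powRN.
have divP (z c : R) : 0 < z -> (z / t) `^ c = z `^ c / t `^ c.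
  move=> z0; rewrite powRM ?invr_ge0 ?(ltW z0) ?(ltW t0)//.
  by rewrite -(powR_inv1 (ltW t0)) -powRrM mulN1r powRN.
have gs0 := gr_neq0 mn0 s0.
rewrite -mulrDl !divP// !powRN !pB// (powRD (nz _ _ t0)).
rewrite (powRr1 (ltW m0)) (powRr1 (ltW n0)) (powRr1 (ltW t0)).
have Gnz (z : R) : 0 < z -> Gamma z != 0 by move=> z0; rewrite gt_eqF// Gamma_gt0.
have := Gnz _ m0; have := Gnz _ n0; have := Gnz _ mn0.
move: (Gamma m) (Gamma n) (Gamma (m + n)) => g1 g2 g3 g30 g20 g10.
have Pnz (z c : R) : 0 < z -> z `^ c != 0 by move=> z0; rewrite gt_eqF// powR_gt0.
have := Pnz _ lambda t0; have := Pnz _ mu t0; have := Pnz _ s t0.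
have := Pnz _ s mn0.
move: (gr lambda m) (gr mu n) (gr s (m + n)) gs0 => h1 h2 h3 h30.
move: (t `^ _) (t `^ _) (t `^ _) ((m + n) `^ _) => v1 v2 v3 v4 v40 v30 v20 v10.
have m1 : m != 0 by rewrite gt_eqF.
have n1 : n != 0 by rewrite gt_eqF.
have t1 : t != 0 by rewrite gt_eqF.
move: (m `^ _) (n `^ _) => w1 w2; field.
by rewrite v30 t1 v20 v10 v40 g30 h30 g20 n1 g10 m1.
Unshelve. all: by end_near. Qed.
End pa_mass_limit.

(** * Monotonicity of the closed form *)

Section pa_mass_monotone.
Variable R : realType.
Implicit Types (lambda mu s a b x y : R) (i j : nat).
Local Notation Gamma := (@Gamma R).

(** Reduces steps in the second argument to steps in the first. *)
Lemma pa_mass_sym lambda mu s a b i j :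
  pa_mass lambda mu s a b i j = pa_mass mu lambda s b a j i.
Proof.
rewrite /pa_mass (addrC j%:R i%:R) (addrC (b * _)).
by rewrite (mulrC (Gamma (i%:R + lambda) / _)).
Qed.

(* [(x + 1)(x + y + s)(ax + by)] times [1 - p(x + 1, y) / p(x, y)]. *)
Definition pa_drop lambda s a b x y :=
  (1 - lambda) * (x + y) * (a * x + b * y) + (x + 1) * (s * (a * x + b * y))
  - (x + lambda) * (a * (x + y)).

(** The Gamma recursion makes the difference of neighbours a nonnegative factor times [pa_drop]; i +
    j > 0 allows the recursion at Gamma(i + j). *)
Lemma pa_mass_step lambda mu s a b i j :
  0 < lambda -> 0 < mu -> 0 < s -> (0 < i + j)%N ->
  0 <= pa_drop lambda s a b i%:R j%:R ->
  pa_mass lambda mu s a b i.+1 j <= pa_mass lambda mu s a b i j.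
Proof.
move=> la0 mu0 s0; rewrite -(ltr_nat R) natrD /pa_mass -(natr1 i).
have x0 : 0 <= i%:R :> R by [].
have y0 : 0 <= j%:R :> R by [].
move: (i%:R) (j%:R) x0 y0 => x y x0 y0 xy D0.
have x1 : 0 < x + 1 by rewrite ltr_wpDl.
have xl : 0 < x + lambda by rewrite ltr_wpDl.
have xys : 0 < x + y + s by rewrite addr_gt0.
have ymu : 0 < y + mu by rewrite ltr_wpDl.
have y1 : 0 < y + 1 by rewrite ltr_wpDl.
rewrite (addrAC x 1 lambda) (addrAC x 1 y) (addrAC (x + y) 1 s).
rewrite (GammaD1 x1) (GammaD1 xl) (GammaD1 xy) (GammaD1 xys).
have := Gamma_gt0 x1; have := Gamma_gt0 xl; have := Gamma_gt0 xys.
have := Gamma_gt0 xy; have := Gamma_gt0 ymu; have := Gamma_gt0 y1.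
move: (Gamma _) (Gamma _) (Gamma _) (Gamma _) (Gamma _) (Gamma _).
move=> g1 g2 g3 g4 g5 g6 p1 p2 p3 p4 p5 p6.
rewrite -subr_ge0.
have -> : g2 / g1 * (g5 / g6) * (g4 / g3) * (a * x + b * y) -
  (x + lambda) * g2 / ((x + 1) * g1) * (g5 / g6) *
  ((x + y) * g4 / ((x + y + s) * g3)) * (a * (x + 1) + b * y) =
  g2 / g1 * (g5 / g6) * (g4 / g3) / ((x + 1) * (x + y + s)) * pa_drop lambda s a b x y.
  rewrite /pa_drop; field.
  by rewrite !gt_eqF.
by rewrite mulr_ge0// !(divr_ge0, mulr_ge0)// ltW// mulr_gt0.
Qed.

Lemma quadratic_eventually_ge0 (A B C : R) : 0 < A ->
  exists M : nat, forall x, M%:R <= x -> 0 <= A * x ^+ 2 + B * x + C.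
Proof.
(* For x >= 1 and x >= Q one has A x^2 >= (|B| + |C|) x, which outweighs both lower terms. *)
move=> A0; pose Q := (`|B| + `|C|) / A.
have Q0 : 0 <= Q by rewrite divr_ge0 ?addr_ge0// ltW.
exists (Num.truncn Q).+1 => x Mx.
have x1 : 1 <= x by rewrite (le_trans _ Mx)// ler1n.
have xQ : Q <= x by rewrite (le_trans _ Mx)// ltW// truncnS_gt.
have {}xQ : `|B| + `|C| <= A * x by rewrite mulrC -ler_pdivrMr.
have hB : - `|B| <= B by rewrite lerNl -normrN ler_norm.
have hC : - `|C| <= C by rewrite lerNl -normrN ler_norm.
have B0 : 0 <= `|B| by []. have C0 : 0 <= `|C| by [].
move: (`|B|) (`|C|) xQ hB hC B0 C0 => b c xQ hB hC B0 C0.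
have : (b + c) * x <= A * x * x by rewrite ler_wpM2r// (le_trans _ x1).
by nra.
Qed.

(** For fixed y this is a quadratic in x with leading coefficient (s - lambda) a > 0; the threshold
    depends on y. *)
Lemma pa_drop_eventually_ge0 lambda s a b y : lambda < s -> 0 < a ->
  exists M : nat, forall x, M%:R <= x -> 0 <= pa_drop lambda s a b x y.
Proof.
move=> ls a0; have sl0 : 0 < (s - lambda) * a by rewrite mulr_gt0// subr_gt0.
have [M hM] := quadratic_eventually_ge0
  ((1 - lambda) * (a * y + b * y) + s * b * y + s * a - a * y - lambda * a)
  ((1 - lambda) * b * y ^+ 2 + s * b * y - lambda * a * y) sl0.
exists M => x /hM; congr (_ <= _); rewrite /pa_drop; ring.
Qed.

Lemma quadratic_form_ge0 (P Q r x y : R) : 0 < P -> r ^+ 2 <= 4 * P * Q ->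
  0 <= P * y ^+ 2 - r * x * y + Q * x ^+ 2.
Proof.
move=> P0 h; rewrite -(pmulr_rge0 _ (_ : 0 < 4 * P)); last by rewrite mulr_gt0.
have -> : 4 * P * (P * y ^+ 2 - r * x * y + Q * x ^+ 2) =
  (2 * P * y - r * x) ^+ 2 + (4 * P * Q - r ^+ 2) * x ^+ 2 by ring.
by rewrite addr_ge0 ?sqr_ge0// mulr_ge0 ?sqr_ge0// subr_ge0.
Qed.

(* If [gamma > s alpha / mu] then [gamma > 3 alpha], which the balance
   hypothesis turns into [1 - lambda > 1/2] and [8 alpha >= 3 gamma lambda]. *)
Lemma pa_discriminant (alpha gamma lambda mu s : R) :
  0 < alpha -> 0 < gamma -> alpha + gamma < 1 ->
  0 < lambda <= 1 -> 0 < mu <= 1 -> 2 + lambda + mu < s ->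
  (1 - gamma) * (1 + mu * (alpha + gamma)) =
    (1 - alpha) * (1 + lambda * (alpha + gamma)) ->
  s * alpha < gamma * mu ->
  lambda < 1 /\ gamma * lambda * mu <= 4 * (1 - lambda) * (s - lambda) * alpha.
Proof.
move=> a0 g0 ag /andP[l0 l1] /andP[m0 m1] hs H hg.
have h3 : 3 * alpha < gamma.
  have : 3 * alpha * mu < gamma * mu by nra.
  by rewrite ltr_pM2r.
(* The balance identity reads (1 - gamma)(mu - lambda)(alpha + gamma) = (gamma - alpha)(1 + lambda
   (alpha + gamma)); bound the last factor below by 1 - gamma, cancel, and use mu <= 1. *)
have h2 : gamma - alpha <= (1 - lambda) * (alpha + gamma).
  have e : (1 - gamma) * ((mu - lambda) * (alpha + gamma)) =
      (gamma - alpha) * (1 + lambda * (alpha + gamma)) by nra.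
  have g1 : 0 < 1 - gamma by lra.
  have : (1 - gamma) * (gamma - alpha) <=
      (1 - gamma) * ((mu - lambda) * (alpha + gamma)).
    rewrite e mulrC ler_wpM2l; nra.
  rewrite ler_pM2l//; nra.
have hl : 1 / 2 < 1 - lambda by nra.
have h4 : (1 - alpha) * lambda * (alpha + gamma) <= 2 * alpha by nra.
have h5 : 3 / 8 * (gamma * lambda) <= alpha.
  have gl : 0 < gamma * lambda by rewrite mulr_gt0.
  have : 3 / 4 * (gamma * lambda) <= (1 - alpha) * (lambda * (alpha + gamma)).
    apply: ler_pM; [lra|exact: ltW|lra|nra].
  rewrite mulrA; lra.
split; first lra.
have gl : 0 < gamma * lambda by rewrite mulr_gt0.
have h6 : 3 * mu <= s - lambda by lra.
have h7 : 3 / 2 * mu <= (1 - lambda) * (s - lambda) by nra.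
(* The constants multiply to 9/16, and 4 times 9/16 exceeds 1. *)
have h8 : 3 / 2 * mu * (3 / 8 * (gamma * lambda)) <=
    (1 - lambda) * (s - lambda) * alpha.
  by apply: ler_pM => //; rewrite ?mulr_ge0// ltW.
by nra.
Qed.

(** If lambda a <= s b, all regrouped coefficients are nonnegative. Otherwise the relations with C
    give s alpha < gamma mu, so [pa_discriminant] controls the quadratic part, and the only other
    negative term, -lambda a y, is absorbed by s b x y for large x. *)
Lemma pa_drop_uniform_ge0 (alpha gamma lambda mu s a b C : R) :
  0 < alpha -> 0 < gamma -> alpha + gamma < 1 ->
  0 < lambda <= 1 -> 0 < mu <= 1 -> 2 + lambda + mu < s ->
  (1 - gamma) * (1 + mu * (alpha + gamma)) =
    (1 - alpha) * (1 + lambda * (alpha + gamma)) ->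
  0 < C -> lambda * a = C * gamma -> mu * b = C * alpha ->
  exists M : nat, forall x y, M%:R <= x -> 0 <= y -> 0 <= pa_drop lambda s a b x y.
Proof.
move=> al0 ga0 ag lab mub hs H C0 la_a mu_b.
have /andP[la0 la1] := lab; have /andP[mu0 mu1] := mub.
have a0 : 0 < a by rewrite -(pmulr_rgt0 _ la0) la_a mulr_gt0.
have b0 : 0 < b by rewrite -(pmulr_rgt0 _ mu0) mu_b mulr_gt0.
have dropE x y : pa_drop lambda s a b x y =
   ((1 - lambda) * b * y ^+ 2 - lambda * a * x * y + (s - lambda) * a * x ^+ 2)
   + (s + 1 - lambda) * b * x * y + (s - lambda) * a * x + (s * b - lambda * a) * y.
  by rewrite /pa_drop; ring.
have sl0 : 0 < s - lambda by lra.
have s0 : 0 < s by lra.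
have [h|h] := leP (lambda * a) (s * b).
  exists 0%N => x y x0 y0.
  have -> : pa_drop lambda s a b x y =
     (1 - lambda) * b * y ^+ 2 + (s - lambda) * a * x ^+ 2 +
     (s * b - lambda * a) * x * y + (1 - lambda) * b * x * y + (s - lambda) * a * x +
     (s * b - lambda * a) * y by rewrite dropE; ring.
  have h1 : 0 <= 1 - lambda by lra.
  have h2 : 0 <= s * b - lambda * a by lra.
  by rewrite !addr_ge0// !mulr_ge0// ?sqr_ge0// ltW.
have hg : s * alpha < gamma * mu.
  rewrite -(ltr_pM2l C0) mulrCA -mu_b [C * _]mulrA -la_a mulrCA.
  rewrite [lambda * a * mu]mulrC ltr_pM2l//.
have [l1 disc] := pa_discriminant al0 ga0 ag lab mub hs H hg.
exists (Num.truncn (lambda * a / (s * b))).+1 => x y Mx y0.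
have hx : lambda * a <= s * b * x.
  rewrite [leRHS]mulrC -ler_pdivrMr ?mulr_gt0// (le_trans _ Mx)//.
  by rewrite ltW// truncnS_gt.
have x0 : 0 <= x by rewrite (le_trans _ Mx).
have Q0 : 0 <= (1 - lambda) * b * y ^+ 2 - lambda * a * x * y +
    (s - lambda) * a * x ^+ 2.
  have := @quadratic_form_ge0 ((1 - lambda) * b) ((s - lambda) * a) (lambda * a) x y.
  apply; first by rewrite mulr_gt0// subr_gt0.
  (* Multiplying by lambda mu allows a and b to be eliminated in favour of C gamma and C alpha. *)
  rewrite -(ler_pM2l (mulr_gt0 la0 mu0)).
  have -> : lambda * mu * (4 * ((1 - lambda) * b) * ((s - lambda) * a)) =
    4 * (1 - lambda) * (s - lambda) * (lambda * a) * (mu * b) by ring.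
  rewrite mu_b la_a.
  have -> : lambda * mu * (C * gamma) ^+ 2 =
    (C ^+ 2 * gamma) * (gamma * lambda * mu) by ring.
  have -> : 4 * (1 - lambda) * (s - lambda) * (C * gamma) * (C * alpha) =
    (C ^+ 2 * gamma) * (4 * (1 - lambda) * (s - lambda) * alpha) by ring.
  by rewrite ler_wpM2l// mulr_ge0 ?sqr_ge0// ltW.
have h1 : 0 <= (1 - lambda) * b * x * y by rewrite !mulr_ge0 ?subr_ge0// ltW.
have h2 : 0 <= (s - lambda) * a * x by rewrite !mulr_ge0// ltW.
have h3 : 0 <= (s * b * x - lambda * a) * y by rewrite mulr_ge0// subr_ge0.
have h4 : 0 <= s * b * y by rewrite !mulr_ge0// ltW.
rewrite dropE; nra.
Qed.

Lemma nonincreasing_from (f : nat -> R) M :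
  (forall i, (M <= i)%N -> f i.+1 <= f i) ->
  forall i i', (M <= i <= i')%N -> f i' <= f i.
Proof.
move=> h i i' /andP[Mi]; elim: i' => [|n IH]; first by rewrite leqn0 => /eqP ->.
rewrite leq_eqVlt => /predU1P[->//|]; rewrite ltnS => ni.
by rewrite (le_trans (h _ _) (IH ni))// (leq_trans Mi).
Qed.

End pa_mass_monotone.

(** * Regular variation, monotonicity and limit for the model *)

Lemma powR_regularly_varying (R : realType) (rho : R) :
  regularly_varying rho (fun t : R => t `^ rho).
Proof.
split=> [t t0||x x0]; first exact: powR_gt0.
  by apply: measurable_funTS; exact: measurable_powR.
apply: (@cvg_trans _ ((fun=> x `^ rho) @ +oo)); last exact: cvg_cst.
apply: near_eq_cvg; near=> t; have t0 : 0 < t by [].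
by rewrite powRM ?(ltW t0) ?(ltW x0)// mulrC mulKf// gt_eqF// powR_gt0.
Unshelve. all: by end_near. Qed.

Theorem proposition3p1 (R : realType) (alpha beta gamma lambda mu : R)
  (n0 : nat) (g0 : digraph)
  (d : measure_display) (Omega : measurableType d) (P : probability Omega R)
  (G : nat -> Omega -> digraph) (p : nat -> nat -> R)
  (hparams : pa_params alpha beta gamma lambda mu)
  (hG : pa_process alpha beta gamma lambda mu n0 g0 P G)
  (hp : asymptotic_joint_pmf P G p)
  (hrep : mixture_representation alpha beta gamma lambda mu p) :
  let c1 := Defs.c1 alpha beta gamma lambda in
  let c2 := Defs.c2 alpha beta gamma mu in
  c1 = c2 ->
  [/\ eventually_decreasing_coordinatewise p /\
      (lambda <= 1 -> mu <= 1 -> eventually_decreasing p),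
      embeddable p,
      standard_regularly_varying p &
      forall x y : R, 0 < x -> 0 < y ->
        p (Num.truncn (n%:R * x)) (Num.truncn (n%:R * y))
          / n%:R `^ (- (2 + 1 / c1)) @[n --> \oo] -->
        gamma / (alpha + gamma)
          * (Gamma (1 + 1 / c1 + lambda + mu)
             / (c1 * Gamma (lambda + 1) * Gamma mu))
          * (x `^ lambda * y `^ (mu - 1)
             / (x + y) `^ (1 + lambda + mu + 1 / c1))
        + alpha / (alpha + gamma)
          * (Gamma (1 + 1 / c1 + lambda + mu)
             / (c1 * Gamma lambda * Gamma (mu + 1)))
          * (x `^ (lambda - 1) * y `^ mu
             / (x + y) `^ (1 + lambda + mu + 1 / c1))].
Proof.
move=> c1 c2 c12; have hpE := mixture_pa_mass hparams hrep c12.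
case: hparams => /andP[al0 al1] /andP[be0 be1] /andP[ga0 ga1] abg [la0 mu0].
have ag0 : 0 < alpha + gamma by rewrite addr_gt0.
have ag1 : alpha + gamma < 1 by lra.
have lambda_lt (z : R) : 0 < z -> lambda < 1 + z + lambda + mu by move=> z0; lra.
have mu_lt (z : R) : 0 < z -> mu < 1 + z + lambda + mu by move=> z0; lra.
have sum_lt (z : R) : 1 < z -> 2 + lambda + mu < 1 + z + lambda + mu.
  by move=> z1; lra.
have d1 : 0 < 1 + lambda * (alpha + gamma) by rewrite addr_gt0 ?mulr_gt0.
have d2 : 0 < 1 + mu * (alpha + gamma) by rewrite addr_gt0 ?mulr_gt0.
(* The numerator alpha + beta of c_1 is below 1 and its denominator above 1; k > 1 yields s > 2 +
   lambda + mu. *)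
have k1 : 1 < 1 / c1.
  rewrite /c1 /Defs.c1 div1r invf_div ltr_pdivlMr ?addr_gt0// mul1r.
  by have := mulr_gt0 la0 ag0; lra.
have H : (1 - gamma) * (1 + mu * (alpha + gamma)) =
    (1 - alpha) * (1 + lambda * (alpha + gamma)).
  have -> : 1 - gamma = alpha + beta by lra.
  have -> : 1 - alpha = beta + gamma by lra.
  move: c12; rewrite /c1 /c2 /Defs.c1 /Defs.c2 => /eqP.
  by rewrite eqr_div ?(gt_eqF d1) ?(gt_eqF d2)// => /eqP.
have c10 : 0 < c1 by rewrite divr_gt0 ?addr_gt0 ?mulr_gt0.
move: hpE; rewrite -/c1 /=; set k := 1 / c1; set s := 1 + k + lambda + mu.
set a := gamma / _ * _; set b := alpha / _ * _ => pE.
have k0 : 0 < k by rewrite divr_gt0.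
have la10 : 0 < lambda + 1 by rewrite addr_gt0.
have mu10 : 0 < mu + 1 by rewrite addr_gt0.
have s0 : 0 < s by rewrite !addr_gt0.
have Gs0 : 0 < Gamma s by exact: Gamma_gt0.
have Gla0 : 0 < Gamma lambda by exact: Gamma_gt0.
have Gmu0 : 0 < Gamma mu by exact: Gamma_gt0.
(* By Gamma(z + 1) = z Gamma(z), lambda a and mu b are gamma and alpha times one common constant,
   the C of [pa_drop_uniform_ge0]. *)
have aE : lambda * a =
    k * Gamma s / ((alpha + gamma) * Gamma lambda * Gamma mu) * gamma.
  rewrite /a (GammaD1 la0); move: (Gamma s) (Gamma lambda) (Gamma mu) Gla0 Gmu0.
  by move=> g1 g2 g3 g20 g30; field; rewrite !gt_eqF.
have bE : mu * b =
    k * Gamma s / ((alpha + gamma) * Gamma lambda * Gamma mu) * alpha.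
  rewrite /b (GammaD1 mu0); move: (Gamma s) (Gamma lambda) (Gamma mu) Gla0 Gmu0.
  by move=> g1 g2 g3 g20 g30; field; rewrite !gt_eqF.
have C0 : 0 < k * Gamma s / ((alpha + gamma) * Gamma lambda * Gamma mu).
  exact: divr_gt0 (mulr_gt0 k0 Gs0) (mulr_gt0 (mulr_gt0 ag0 Gla0) Gmu0).
have a0 : 0 < a by rewrite -(pmulr_rgt0 _ la0) aE mulr_gt0.
have b0 : 0 < b by rewrite -(pmulr_rgt0 _ mu0) bE mulr_gt0.
pose rho := - (2 + k).
pose l (x y : R) :=
  x `^ (lambda - 1) * y `^ (mu - 1) * (x + y) `^ (- s) * (a * x + b * y).
have l0 x y : 0 < x -> 0 < y -> 0 < l x y.
  move=> x0 y0; have xy0 := addr_gt0 (mulr_gt0 a0 x0) (mulr_gt0 b0 y0).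
  by apply: mulr_gt0 => //; rewrite !mulr_gt0 ?powR_gt0 ?addr_gt0.
have lim x y : 0 < x -> 0 < y ->
    p (Num.truncn (t * x)) (Num.truncn (t * y)) / t `^ rho @[t --> +oo] --> l x y.
  move=> x0 y0; have := @pa_mass_cvg R lambda mu s a b x y la0 mu0 s0 x0 y0.
  have -> : lambda + mu - 1 - s = rho by rewrite /rho /s; ring.
  (* The closed form excludes (0, 0); t x >= 1 makes the first index positive. *)
  apply: cvg_trans; apply: near_eq_cvg; near=> t; rewrite pE//.
  rewrite addn_gt0; apply/orP; left; rewrite truncn_gt0.
  by rewrite -ler_pdivrMr//; near: t; apply: nbhs_pinfty_ge; rewrite num_real.
have limn x y : 0 < x -> 0 < y ->
    p (Num.truncn (n%:R * x)) (Num.truncn (n%:R * y)) / n%:R `^ rho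
      @[n --> \oo] --> l x y.
  move=> x0 y0; apply: (@cvg_comp _ _ _ (fun n => n%:R : R)
    (fun t => p (Num.truncn (t * x)) (Num.truncn (t * y)) / t `^ rho)
    _ (pinfty_nbhs R)); last exact: lim.
  exact: cvgr_idn.
have drop_step i j : (0 < i + j)%N -> 0 <= pa_drop lambda s a b i%:R j%:R ->
    p i.+1 j <= p i j.
  by move=> ij h; rewrite !pE// pa_mass_step.
have drop_step' i j : (0 < i + j)%N -> 0 <= pa_drop mu s b a j%:R i%:R ->
    p i j.+1 <= p i j.
  move=> ij h; rewrite !pE ?addnS// !(pa_mass_sym lambda).
  by rewrite pa_mass_step// addnC.
split.
- split.
    split=> [j|i].
      have [|M hM] := @pa_drop_eventually_ge0 R lambda s a b j%:R _ a0.
        exact: lambda_lt.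
      (* [M.+1] rather than [M] keeps i positive, so the origin is avoided even for j = 0. *)
      exists M.+1; apply: (@nonincreasing_from R (p^~ j)) => i Mi.
      apply: drop_step; first by rewrite addn_gt0 (leq_trans _ Mi).
      by apply: hM; rewrite ler_nat ltnW.
    have [|M hM] := @pa_drop_eventually_ge0 R mu s b a i%:R _ b0.
      exact: mu_lt.
    exists M.+1; apply: (@nonincreasing_from R (p i)) => j Mj.
    apply: drop_step'; first by rewrite addn_gt0 (leq_trans _ Mj) ?orbT.
    by apply: hM; rewrite ler_nat ltnW.
  move=> la1 mu1.
  have sgt : 2 + lambda + mu < s by exact: sum_lt.

  have [||M hM] := pa_drop_uniform_ge0 al0 ga0 ag1 _ _ sgt H C0 aE bE.
  + by rewrite la0.
  + by rewrite mu0.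
  (* For the second argument alpha and gamma, lambda and mu, a and b trade places, and the balance
     identity is read backwards. *)
  have H' : (1 - alpha) * (1 + lambda * (gamma + alpha)) =
      (1 - gamma) * (1 + mu * (gamma + alpha)) by rewrite [gamma + _]addrC.
  have sgt' : 2 + mu + lambda < s by rewrite (addrAC 2 mu).
  have ag1' : gamma + alpha < 1 by rewrite (addrC gamma).
  have [||M' hM'] := pa_drop_uniform_ge0 ga0 al0 ag1' _ _ sgt' H' C0 bE aE.
  + by rewrite mu0.
  + by rewrite la0.
  exists (maxn M M').+1; split=> [i i' j ii' Mj|i j j' Mi jj'].
    apply: (@nonincreasing_from R (p^~ j) _ _ i i' ii') => n Mn.
    apply: drop_step; first by rewrite addn_gt0 (leq_trans _ Mn).
    by apply: hM => //; rewrite ler_nat (leq_trans _ (ltnW Mn))// leq_maxl.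
  apply: (@nonincreasing_from R (p i) _ _ j j' jj') => n Mn.
  apply: drop_step'; first by rewrite addn_gt0 (leq_trans _ Mn) ?orbT.
  by apply: hM' => //; rewrite ler_nat (leq_trans _ (ltnW Mn))// leq_maxr.
- exists rho, (fun t => t `^ rho); split; first exact: powR_regularly_varying.
  by move=> x y x0 y0; exists (l x y); [exact: l0|exact: lim].
- exists rho, (fun t => t `^ rho); split; first exact: powR_regularly_varying.
  by move=> x y x0 y0; exists (l x y); [exact: l0|exact: limn].
move=> x y x0 y0; have := limn x y x0 y0; congr (_ --> _).
have sE : 1 + lambda + mu + 1 / c1 = s by rewrite /s /k; ring.
rewrite sE /l /a /b.
(* Splitting x^lambda = x x^(lambda-1), and likewise for y, distributes the linear factor a x + b y
   over the two terms of the limit. *)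
rewrite -(mulr_powRB1 (ltW x0) la0) -(mulr_powRB1 (ltW y0) mu0) powRN /k.
have Gla10 := Gamma_gt0 la10; have Gmu10 := Gamma_gt0 mu10.
have xy0 : 0 < (x + y) `^ s by rewrite powR_gt0// addr_gt0.
have alg (c z u v w g g1 g2 g3 g4 : R) : 0 < c -> 0 < z -> 0 < u -> 0 < g1 ->
    0 < g2 -> 0 < g3 -> 0 < g4 ->
    v * w / u * (gamma / z * (1 / c * g / (g3 * g2)) * x +
                 alpha / z * (1 / c * g / (g1 * g4)) * y) =
    gamma / z * (g / (c * g3 * g2)) * (x * v * w / u) +
    alpha / z * (g / (c * g1 * g4)) * (v * (y * w) / u).
  by move=> c0 z0 u0 p1 p2 p3 p4; field; rewrite !gt_eqF.
exact: alg.
Unshelve. all: by end_near. Qed.
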